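(* Let $(X,\mathcal{A},m)$ be a probability space, $T:X\to X$ a measurable map that is non-singular with respect to $m$, and $P:L^1(m)\to L^1(m)$ its Perron-Frobenius operator. Let $\mathcal{B}\subset L^1(m)$ be a subspace with a norm $\|\cdot\|_{\mathcal{B}}$ satisfying conditions (1)-(7) listed in the context, and assume that $1$ is a simple eigenvalue of $P$ on $\mathcal{B}$ and that $P$ has no other eigenvalue of modulus $1$ on $\mathcal{B}$. Let $\mu$ be the unique $T$-invariant probability measure with $\mu\ll m$ and $\frac{d\mu}{dm}\in\mathcal{B}$. Let $\phi:X\to\mathbb{R}$ be a bounded function belonging to $\mathcal{B}$ with $\int\phi\,d\mu=0$, put $S_n=\sum_{k=0}^{n-1}\phi\circ T^k$, and let $\sigma^2=\lim_{n\to\infty}\int\left(\frac{S_n}{\sqrt{n}}\right)^2 d\mu$ (this limit exists). Then for every probability measure $\nu$ with $\nu\ll m$ and $\frac{d\nu}{dm}\in\mathcal{B}$, $\frac{S_n}{\sqrt{n}}$ converges in distribution to $\mathcal{N}(0,\sigma^2)$ in the probability space $(X,\mathcal{A},\nu)$: for every bounded continuous function $g:\mathbb{R}\to\mathbb{R}$, $$\lim_{n\to\infty}\int g\left(\frac{S_n}{\sqrt{n}}\right)d\nu=\int g\,d\mathcal{N}(0,\sigma^2).$$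
   Context: All function spaces consist of ($m$-a.e. equivalence classes of) complex-valued functions. The Perron-Frobenius (transfer) operator $P:L^1(m)\to L^1(m)$ of $T$ is defined by $Pf=\frac{dm_f}{dm}$, where $m_f(A)=\int_{T^{-1}A}f\,dm$; equivalently $\int f\,(g\circ T)\,dm=\int (Pf)\,g\,dm$ for $f\in L^1(m)$, $g\in L^\infty(m)$. Conditions on $\mathcal{B}$: (1) $(\mathcal{B},\|\cdot\|_{\mathcal{B}})$ is a complex Banach space and the inclusion $\mathcal{B}\to L^1(m)$ is continuous; (2) constant functions lie in $\mathcal{B}$; (3) there is $C>0$ such that for all $f,g\in\mathcal{B}$, $fg\in\mathcal{B}$ and $\|fg\|_{\mathcal{B}}\le C\|f\|_{\mathcal{B}}\|g\|_{\mathcal{B}}$ (Banach algebra); (4) $\mathcal{B}$ is a complex Banach lattice: for every $f\in\mathcal{B}$, $\bar f\in\mathcal{B}$ and $|f|\in\mathcal{B}$; (5) $P(\mathcal{B})\subset\mathcal{B}$; (6) $P$ is a bounded operator on $\mathcal{B}$ with spectral radius equal to $1$; (7) $P$ is quasi-compact of diagonal type on $\mathcal{B}$: there is a decomposition $P=\sum_{i=1}^s\lambda_i\Pi_i+Q$, where the $\lambda_i$ are complex numbers of modulus $1$, the $\Pi_i$ are finite-rank projections with $\Pi_i\Pi_j=0$ for $i\ne j$, and $Q$ is a bounded operator on $\mathcal{B}$ with spectral radius strictly less than $1$ and $Q\Pi_i=\Pi_iQ=0$ for all $i$. Under these conditions and the simplicity of the eigenvalue $1$, there is exactly one $T$-invariant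 probability measure $\mu\ll m$ with density in $\mathcal{B}$. $\mathcal{N}(0,\sigma^2)$ denotes the Dirac mass $\delta_0$ if $\sigma^2=0$, and the probability measure on $\mathbb{R}$ with Lebesgue density $\frac{1}{\sigma\sqrt{2\pi}}e^{-\frac{t^2}{2\sigma^2}}$ if $\sigma^2>0$. *)

(* Defs.v *)
(* MathComp-Analysis, with complex scalars R[i] from mathcomp-real-closed. *)
From HB Require Import structures.
From mathcomp Require Import all_boot all_order all_algebra.
From mathcomp Require Import complex.
From mathcomp Require Import all_classical all_reals all_analysis.

Set Implicit Arguments.
Unset Strict Implicit.
Unset Printing Implicit Defensive.

Import Order.TTheory GRing.Theory Num.Theory.
Import numFieldNormedType.Exports.

Local Open Scope classical_set_scope.
Local Open Scope ring_scope.
Local Open Scope complex_scope.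

(* The norm of a normedModType over R[i] takes its values in R[i]; they are
   real, and [rnorm] is the same norm with values in R.  For R[i]^o it is the
   complex modulus. *)
Definition rnorm (R : realType) (V : normedModType R[i]) (v : V) : R :=
  complex.Re `|v|.

Section complex_L1.
Context d (X : measurableType d) (R : realType) (m : probability X R).

(* The library has no measurable structure on R[i]: measurability and
   integrability of complex-valued functions are expressed componentwise. *)
Definition cintegrable (f : X -> R[i]) : Prop :=
  m.-integrable setT (fun x => (complex.Re (f x))%:E) /\
  m.-integrable setT (fun x => (complex.Im (f x))%:E).

(* A complex Banach space continuously included in L^1(m).  Elements of L^1(m)
   are m-a.e. classes: [repr_fun f] is a representative of the class of [f],
   and the fields say that the class of [repr_fun f] lies in L^1(m) and depends
   linearly, injectively and continuously on [f]. *)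
Record L1_banach_space := L1BanachSpace {
  L1_banach_sort :> completeNormedModType R[i] ;
  repr_fun : L1_banach_sort -> X -> R[i] ;
  repr_fun_integrable : forall f, cintegrable (repr_fun f) ;
  repr_fun_linear : forall (a : R[i]) (f g : L1_banach_sort),
    {ae m, forall x,
      repr_fun (a *: f + g) x = a * repr_fun f x + repr_fun g x} ;
  repr_fun_inj : forall f, {ae m, forall x, repr_fun f x = 0} -> f = 0 ;
  repr_fun_continuous : exists K : R, forall f,
    (\int[m]_x (rnorm (repr_fun f x : R[i]^o))%:E <= (K * rnorm f)%:E)%E }.

(* The class of [u] belongs to [B]. *)
Definition in_space (B : L1_banach_space) (u : X -> R[i]) : Prop :=
  exists f : B, {ae m, forall x, repr_fun f x = u x}.

Section transfer_operator.
Variable T : {mfun X >-> X}.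

(* The charge A |-> \int_(T^-1 A) f dm. *)
Definition image_charge (f : X -> \bar R) (intf : m.-integrable setT f) :
  set X -> \bar R := pushforward (induced_charge intf) T.

HB.instance Definition _ f (intf : m.-integrable setT f) :=
  Charge.copy (image_charge intf)
    (measure_function_pushforward__canonical__charge_Charge
       (induced_charge intf) (@measurable_funPT _ _ _ _ T)).

Definition transfer (f : X -> R[i]) (intf : cintegrable f) : X -> R[i] :=
  fun x =>
    fine (Radon_Nikodym (image_charge intf.1) m x) +i*
    fine (Radon_Nikodym (image_charge intf.2) m x).

End transfer_operator.

Definition density (nu : probability X R) : X -> R :=
  fun x => fine (Radon_Nikodym (charge_of_finite_measure nu) m x).

End complex_L1.

Section operators.
Context (R : realType) (V : normedModType R[i]).
Implicit Types A : V -> V.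

Definition bounded_operator A : Prop :=
  exists M : R, forall v, rnorm (A v) <= M * rnorm v.

(* z lies outside the spectrum iff z - A has a bounded two-sided inverse. *)
Definition spectrum A : set R[i] :=
  [set z | ~ exists S : {linear V -> V}, [/\ bounded_operator S,
             (forall v, S (z *: v - A v) = v) &
             (forall v, z *: S v - A (S v) = v)]].

Definition spectral_radius A : \bar R :=
  ereal_sup [set (rnorm (z : R[i]^o))%:E | z in spectrum A].

Definition is_eigenvalue A (z : R[i]) : Prop :=
  exists2 v, v != 0 & A v = z *: v.

(* Algebraic simplicity: the generalized eigenspace is a line. *)
Definition simple_eigenvalue A (z : R[i]) : Prop :=
  exists2 v, v != 0 /\ A v = z *: v &
    forall n w, iter n (fun u => A u - z *: u) w = 0 ->
      exists c : R[i], w = c *: v.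

Definition finite_rank A : Prop :=
  exists n (e : 'I_n -> V), forall v,
    exists c : 'I_n -> R[i], A v = \sum_(i < n) c i *: e i.

Definition quasi_compact_diagonal A : Prop :=
  exists s (lambda : 'I_s -> R[i]) (Pi : 'I_s -> {linear V -> V})
         (Q : {linear V -> V}),
    [/\ (forall v, A v = \sum_(i < s) lambda i *: Pi i v + Q v),
        (forall i, `|lambda i| = 1),
        (forall i, finite_rank (Pi i) /\ forall v, Pi i (Pi i v) = Pi i v),
        (forall i j, i != j -> forall v, Pi i (Pi j v) = 0) &
        [/\ bounded_operator Q,
            (spectral_radius Q < 1)%E &
            forall i v, Q (Pi i v) = 0 /\ Pi i (Q v) = 0]].

End operators.

Definition birkhoff_sum (X : Type) (R : realType) (T : X -> X) (phi : X -> R)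
    (n : nat) (x : X) : R :=
  \sum_(k < n) phi (iter k T x).

(* The centered normal law of variance [v] (meant for v >= 0); the second
   parameter of [normal_prob] is the standard deviation. *)
Definition centered_normal (R : realType) (v : R) :
    probability (measurableTypeR R) R :=
  if v == 0 then [the probability (measurableTypeR R) R of
                   @dirac _ (measurableTypeR R) (0 : R) R]
  else [the probability (measurableTypeR R) R of normal_prob 0 (Num.sqrt v)].

(* Main.v *)
(* Since 1 is simple and the only peripheral eigenvalue, P = Pi + Q with
   Pi v = (\int v dm) h, where h is the density of mu, and 1 - Q is invertible
   because 1 is not in the spectrum of Q.  So u - P u = P w has a solution u in B
   whenever \int w dm = 0; no rate of decay of Q^n is needed.

   Let u1 solve this equation for w = phi h, let
   sigma^2 = \int (phi^2 h + 2 phi u1) dm, and let u2 solve it for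
   w = phi^2 h / 2 + phi u1 - sigma^2 h / 2.  Then h + i e u1 - e^2 u2 is, up to
   O(e^3), an eigenvector of v |-> P (exp (i e phi) v) for the eigenvalue
   1 - e^2 sigma^2 / 2.  These perturbed operators contract L^1(m), so iterating
   n times with e = t / sqrt n costs O(1 / sqrt n) and yields the characteristic
   function under mu.  Taking test functions x^2 instead gives the variance, and
   a density f in B is reduced to h by solving the equation for w = f - h.

   Convergence of the integrals of cos (t x - a) passes to Gaussian bumps, which
   are mixtures of cosines, then to compactly supported functions, which are
   uniform limits of mixtures of Gaussian bumps, then to bounded continuous
   functions by a cut-off. *)

Require Import Defs.
From HB Require Import structures.
From mathcomp Require Import all_boot all_order all_algebra.
From mathcomp Require Import complex.
From mathcomp Require Import all_classical all_reals all_analysis.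
From mathcomp Require Import measurable_realfun ring lra.

Set Implicit Arguments.
Unset Strict Implicit.
Unset Printing Implicit Defensive.

Import Order.TTheory GRing.Theory Num.Theory.
Import numFieldNormedType.Exports.

Local Open Scope classical_set_scope.
Local Open Scope ring_scope.

(** * Bounded factors and dominated convergence for real integrals *)

Section integral_lemmas.
Context d (T : measurableType d) (R : realType).

(** Expanding [P (exp (i e phi) (h + i e u1 - e^2 u2))] dictates the two equations: order e asks for
    [u1 = P (u1 + phi h)], order e^2 for [u2 = P (u2 + phi u1 + phi^2 h / 2 - sigma^2 h / 2)], the
    last term coming from the eigenvalue. Multiplication by phi precedes P, hence a right-hand side
    [P w] instead of [w]; and sigma^2 is the only value for which the second [w] has mean zero. With
    e of order 1 / sqrt n, a defect o(1 / n) per step is needed over n steps, so the expansion must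
    reach order two. B serves to solve the equations; all errors are then measured in L^1(m).

    The argument is run in dual, real form. P is seen only through
    [\int (P u) G dm = \int u (G o T) dm] for bounded G, and the free phase a in [cos (t x - a)]
    carries real and imaginary parts at once. The phase is also what centres a Gaussian bump at a
    given point when cosines are mixed. *)

Lemma bounded_integrable (P : probability T R) (f : T -> R) (M : R) :
  measurable_fun setT f -> (forall x, `|f x| <= M) ->
  P.-integrable setT (EFin \o f).
Proof.
move=> mf fM; apply: measurable_bounded_integrable => //.
  by rewrite (le_lt_trans (probability_le1 P _))// ltry.
exists M; split; first exact: num_real.
by move=> y My x _; exact: le_trans (fM x) (ltW My).
Qed.

Lemma integrable_boundedM (mu : {measure set T -> \bar R}) (f w : T -> R) (M : R) :
  measurable_fun setT f -> (forall x, `|f x| <= M) ->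
  mu.-integrable setT (EFin \o w) ->
  mu.-integrable setT (EFin \o (fun x => f x * w x)).
Proof.
move=> mf fM iw.
have bf : [bounded f x | x in setT].
  exists M; split; first exact: num_real.
  by move=> y My x _; exact: le_trans (fM x) (ltW My).
exact: eq_integrable (@integrableMr _ _ _ mu _ measurableT f (EFin \o w) mf bf iw).
Qed.

Lemma le_norm_Rintegral_boundedM (mu : {measure set T -> \bar R}) (f w : T -> R)
    (M : R) :
  measurable_fun setT f -> (forall x, `|f x| <= M) ->
  mu.-integrable setT (EFin \o w) ->
  `|\int[mu]_x (f x * w x)| <= M * \int[mu]_x `|w x|.
Proof.
move=> mf fM iw; have ifw := integrable_boundedM mf fM iw.
apply: le_trans (le_normr_Rintegral _ ifw) _ => //.
rewrite -RintegralZl//; last exact: integrable_norm.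
apply: le_Rintegral => //.
- exact: (integrable_norm ifw).
- rewrite (_ : _ \o _ = (fun x => M%:E * (EFin \o (Num.norm \o w)) x)%E)//.
  by apply: integrableZl => //; exact: integrable_norm.
- by move=> x _; rewrite normrM ler_wpM2r.
Qed.

Lemma dominated_cvg_Rintegral (mu : {measure set T -> \bar R})
    (f_ : nat -> T -> R) (f g : T -> R) :
  (forall n, measurable_fun setT (f_ n)) ->
  (forall x, f_ n x @[n --> \oo] --> f x) ->
  (forall n x, `|f_ n x| <= g x) ->
  mu.-integrable setT (EFin \o g) ->
  \int[mu]_x f_ n x @[n --> \oo] --> \int[mu]_x f x.
Proof.
move=> mf_ f_f f_g ig.
have mf : measurable_fun setT f.
  apply/measurable_EFinP.
  apply: (@emeasurable_fun_cvg _ _ _ setT (fun n => EFin \o f_ n)) => [n|x _].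
    exact/measurable_EFinP.
  by apply/cvg_EFin; [exact: nearW|exact: f_f].
have m1 n : measurable_fun setT (EFin \o f_ n) by exact/measurable_EFinP.
have m2 : measurable_fun setT (EFin \o f) by exact/measurable_EFinP.
have c : {ae mu, forall x, setT x ->
    (fun n => (EFin \o f_ n) x) @ \oo --> (EFin \o f) x}.
  by apply: aeW => x _; apply/cvg_EFin; [exact: nearW|exact: f_f].
have b : {ae mu, forall x n, setT x -> (`|(EFin \o f_ n) x| <= (EFin \o g) x)%E}.
  by apply: aeW => x n _; rewrite /= lee_fin.
have [fi _ h] := dominated_convergence measurableT m1 m2 c ig b.
apply: fine_cvg; rewrite fineK//; exact: integrable_fin_num.
Qed.
End integral_lemmas.

(** * Gaussian integrals *)

Section gaussian.
Context (R : realType).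
Implicit Types m s x t a : R.
Notation mu := lebesgue_measure.

(** The rate is asked at positive indices only, so that users may divide by [Num.sqrt n.+1%:R]. *)
Lemma cvgn_sqrt_bound (u : nat -> R) (l K : R) :
  (forall n, `|u n.+1 - l| * Num.sqrt n.+1%:R <= K) -> u n @[n --> \oo] --> l.
Proof.
move=> uK; apply/cvgrPdist_le => e e0; near=> n.
have n0 : (0 < n)%N by near: n; exists 1%N.
have K0 : 0 <= K by rewrite (le_trans _ (uK 0%N)).
rewrite distrC -(prednK n0).
have q0 : 0 < Num.sqrt n.-1.+1%:R :> R by rewrite sqrtr_gt0.
rewrite -(ler_pM2r q0) (le_trans (uK _))// -ler_pdivrMl//.
rewrite -[leLHS]ger0_norm; last by rewrite mulr_ge0// invr_ge0 ltW.
rewrite -sqrtr_sqr ler_sqrt// prednK//.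
near: n; exact: nbhs_infty_ger.
Unshelve. all: end_near. Qed.

Lemma continuous_measurable_funTR (f : R -> R) : continuous f ->
  @measurable_fun _ _ (measurableTypeR R) R setT f.
Proof. by move=> cf; exact: (continuous_measurable_fun cf). Qed.

(** As -1/2 + 1/4 = -1/4, half of the exponent can be given away and a Gaussian of deviation
    [Num.sqrt 2 * s] remains. Polynomial factors are absorbed by the given-away part through
    [1 + y <= expR y], which yields the moment bounds below. *)
Lemma normal_pdf_widen m s x : s != 0 ->
  normal_pdf m s x * expR ((x - m) ^+ 2 / (4 * s ^+ 2)) =
  Num.sqrt 2 * normal_pdf m (Num.sqrt 2 * s) x.
Proof.
move=> s0; have r0 : Num.sqrt 2 != 0 :> R by rewrite gt_eqF// sqrtr_gt0.
rewrite !normal_pdfE ?mulf_neq0// /normal_peak /normal_fun -mulrA -expRD.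
have -> : (Num.sqrt 2 * s) ^+ 2 = 2 * s ^+ 2 by rewrite exprMn sqr_sqrtr.
have -> : 2 * s ^+ 2 * pi *+ 2 = 2 * (s ^+ 2 * pi *+ 2).
  by rewrite -mulrA mulrnAr.
rewrite sqrtrM//; set k := Num.sqrt _; rewrite [(_ * k)^-1]invfM -!mulrA mulVKf//.
congr (_ * expR _).
by field.
Qed.

(** Dominated convergence under [|f|] makes the integral the limit of those over [J n], each an
    increment of [F]; decay along the integers is then enough. Endpoints at [n.+1] keep the interval
    nondegenerate for the fundamental theorem. *)
Lemma integral_derive_vanishing (f F : R -> R) :
  mu.-integrable setT (EFin \o f) -> continuous f ->
  (forall x, is_derive x 1 F (f x)) ->
  F n%:R @[n --> \oo] --> 0 -> F (- n%:R) @[n --> \oo] --> 0 ->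
  \int[mu]_x f x = 0.
Proof.
move=> intf cf dF Fp Fn.
pose J n := `[- n.+1%:R, n.+1%:R]%classic : set R.
have : \int[mu]_x (f x * \1_(J n) x) @[n --> \oo] --> \int[mu]_x f x.
  apply: (@dominated_cvg_Rintegral _ (measurableTypeR R) R mu (fun n x => f x * \1_(J n) x) f (fun x => `|f x|)).
  - move=> n; apply: measurable_funM; last first.
      by apply: measurable_indic; exact: measurable_itv.
    by move: intf => /measurable_int/measurable_EFinP.
  - move=> x; apply: cvg_near_cst; exists (Num.truncn `|x|) => // n /= xn.
    have Jx : J n x.
      rewrite /J /= in_itv/= -ler_norml (le_trans (ltW (truncnS_gt _)))//.
      by rewrite ler_nat ltnS.
    by rewrite indicE mem_set// mulr1.
  - move=> n x; rewrite normrM ler_piMr// indicE; case: (_ \in _) => /=.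
      by rewrite normr1.
    by rewrite normr0.
  - exact: integrable_norm.
have -> : (fun n => \int[mu]_x (f x * \1_(J n) x)) = (fun n => F n.+1%:R - F (- n.+1%:R)).
  apply/funext => n.
  have ab : - n.+1%:R < n.+1%:R :> R by rewrite gtrN// ltr0n.
  have cF : continuous F.
    by move=> x; apply/differentiable_continuous/derivable1_diffP/ex_derive.
  transitivity (\int[mu]_(x in J n) f x).
    by rewrite [RHS]Rintegral_mkcond; apply: eq_Rintegral => x _; rewrite patch_indic.
  rewrite /Rintegral (@continuous_FTC2 _ f F)//.
  - by apply: continuous_subspaceT.
  - split.
    + by move=> x _; exact: ex_derive.
    + by apply: cvg_at_right_filter; exact: cF.
    + by apply: cvg_at_left_filter; exact: cF.
  - by move=> x _; rewrite derive1E; exact: derive_val.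
move=> h.
have h0 : F n.+1%:R - F (- n.+1%:R) @[n --> \oo] --> (0 - 0 : R).
  apply: cvgB.
    by rewrite (@cvg_shiftS _ (fun n => F n%:R)).
  by rewrite (@cvg_shiftS _ (fun n => F (- n%:R))).
by rewrite subr0 in h0; exact: (cvg_unique _ h h0).
Qed.

(** By AM-GM, [|x - m| <= |s| * (1 + (x - m)^2 / (4 s^2))], and the bracket is at most the
    exponential of [normal_pdf_widen]. *)
Lemma normr_normal_pdf_le m s x : s != 0 ->
  `|x - m| * normal_pdf m s x <=
  `|s| * (Num.sqrt 2 * normal_pdf m (Num.sqrt 2 * s) x).
Proof.
move=> s0; rewrite -normal_pdf_widen// mulrC mulrCA ler_wpM2l ?normal_pdf_ge0//.
have b0 : 0 < `|s| by rewrite normr_gt0.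
apply: le_trans (ler_wpM2l (ltW b0) (expR_ge1Dx _)).
rewrite -(real_normK (num_real s)) -(real_normK (num_real (x - m))).
move: `|s| b0 `|x - m| => b b0 c; rewrite -subr_ge0.
have -> : b * (1 + c ^+ 2 / (4 * b ^+ 2)) - c = (c - 2 * b) ^+ 2 / (4 * b).
  by field; rewrite gt_eqF.
by rewrite divr_ge0 ?sqr_ge0// mulr_ge0// ltW.
Qed.

(** Plays the part of Chebyshev's inequality in [mollified_close]. *)
Lemma sqr_normal_pdf_le m s x : s != 0 ->
  (x - m) ^+ 2 * normal_pdf m s x <=
  4 * s ^+ 2 * (Num.sqrt 2 * normal_pdf m (Num.sqrt 2 * s) x).
Proof.
move=> s0; have s2 : 0 < s ^+ 2 by rewrite exprn_even_gt0.
rewrite -normal_pdf_widen// [leLHS]mulrC [leRHS]mulrCA ler_wpM2l ?normal_pdf_ge0//.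
rewrite -ler_pdivrMl; last by rewrite mulr_gt0. rewrite mulrC.
by rewrite (le_trans _ (expR_ge1Dx _))// lerDr.
Qed.

Lemma integrable_normr_normal_pdf m s : s != 0 ->
  mu.-integrable setT (EFin \o (fun x => `|x - m| * normal_pdf m s x)).
Proof.
move=> s0; apply: (@le_integrable _ _ _ mu _ measurableT _
  (fun x => (`|s| * Num.sqrt 2)%:E * (normal_pdf m (Num.sqrt 2 * s) x)%:E)%E).
- apply/measurable_EFinP; apply: measurable_funM.
    by apply: measurableT_comp => //; exact: measurable_funB.
  exact: measurable_normal_pdf.
- move=> x _ /=; rewrite lee_fin ger0_norm ?mulr_ge0 ?normal_pdf_ge0//.
  by rewrite (le_trans (normr_normal_pdf_le _ _ s0))// mulrA ler_norm.
- by apply: integrableZl => //; exact: integrable_normal_pdf.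
Qed.

Lemma continuous_cosB t a : continuous (fun x : R => cos (t * x - a)).
Proof.
move=> x; apply: (@continuous_comp _ _ _ (fun x => t * x - a) cos); last exact: continuous_cos.
by apply: cvgB; [apply: cvgMr; exact: cvg_id|exact: cvg_cst].
Qed.

Lemma continuous_sinB t a : continuous (fun x : R => sin (t * x - a)).
Proof.
move=> x; apply: (@continuous_comp _ _ _ (fun x => t * x - a) sin); last exact: continuous_sin.
by apply: cvgB; [apply: cvgMr; exact: cvg_id|exact: cvg_cst].
Qed.

Lemma is_derive_normal_pdf0 s x : s != 0 ->
  is_derive x 1 (normal_pdf 0 s) (- (x / s ^+ 2) * normal_pdf 0 s x).
Proof.
move=> s0; rewrite normal_pdfE// /normal_fun.
have -> : (fun x0 : R => normal_peak s * expR (- (x0 - 0) ^+ 2 / (s ^+ 2 *+ 2))) =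
  (fun x0 : R => normal_peak s * expR (- (s ^+ 2 *+ 2)^-1 * x0 ^+ 2)).
  apply/funext => y; congr (_ * expR _).
  by rewrite subr0 !mulNr; congr (- _); exact: mulrC.
apply: is_derive_eq.
rewrite /GRing.scale /= !(mulr1, mulr0, add0r, addr0) subr0.
have -> : - x ^+ 2 / (s ^+ 2 *+ 2) = - (s ^+ 2 *+ 2)^-1 * x ^+ 2 by field.
by field.
Qed.

(** The integral [Phi] solves [Phi' = - s^2 t Phi]: differentiation under the integral sign, with
    majorant [|x| p], produces the integral of [sin (t x - a) x p], and [x p = - s^2 p'] allows an
    integration by parts. Hence [Phi] times [expR (s^2 t^2 / 2)] is constant, equal to [cos a] at
    0. *)
Lemma normal_char s t a : s != 0 ->
  \int[mu]_x (cos (t * x - a) * normal_pdf 0 s x) =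
  cos a * expR (- ((s * t) ^+ 2 / 2)).
Proof.
move=> s0; pose p := normal_pdf 0 s.
have ip : mu.-integrable setT (EFin \o p) := integrable_normal_pdf 0 s.
have ixp : mu.-integrable setT (EFin \o (fun x => `|x| * p x)).
  have := integrable_normr_normal_pdf 0 s0.
  by under eq_fun do rewrite subr0.
have ixp' : mu.-integrable setT (EFin \o (fun x => x * p x)).
  apply: le_integrable ixp => //.
    apply/measurable_EFinP; apply: measurable_funM => //.
    exact: measurable_normal_pdf.
  by move=> x _ /=; rewrite lee_fin !normrM normr_id.
have mcos t' : measurable_fun setT (fun x : measurableTypeR R => cos (t' * x - a)).
  by apply: continuous_measurable_funTR; exact: continuous_cosB.
have msin t' : measurable_fun setT (fun x : measurableTypeR R => sin (t' * x - a)).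
  by apply: continuous_measurable_funTR; exact: continuous_sinB.
have icos t' : mu.-integrable setT (EFin \o (fun x => cos (t' * x - a) * p x)).
  exact: (integrable_boundedM (mcos t') (fun x => cos_max _) ip).
have isin t' : mu.-integrable setT (EFin \o (fun x => sin (t' * x - a) * (x * p x))).
  exact: (integrable_boundedM (msin t') (fun x => sin_max _) ixp').
pose Phi t' := \int[mu]_x (cos (t' * x - a) * p x).
have parts t' : \int[mu]_x (sin (t' * x - a) * (x * p x)) = s ^+ 2 * t' * Phi t'.
  pose f x := t' * (cos (t' * x - a) * p x) - (s ^+ 2)^-1 * (sin (t' * x - a) * (x * p x)).
  pose F x := sin (t' * x - a) * p x.
  have if1 : mu.-integrable setT (EFin \o (fun x => t' * (cos (t' * x - a) * p x))).
    exact: (integrableZl measurableT t' (icos t')).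
  have if2 : mu.-integrable setT (EFin \o (fun x => (s ^+ 2)^-1 * (sin (t' * x - a) * (x * p x)))).
    exact: (integrableZl measurableT (s ^+ 2)^-1 (isin t')).
  (* A bound of [|x| p], the wider Gaussian being at most its peak. Since [sqrt (n+1) <= n+1 = |x|],
     it also bounds [|F x| sqrt (n+1)], so the boundary terms vanish. *)
  pose K := `|s| * (Num.sqrt 2 * normal_peak (Num.sqrt 2 * s)).
  have FK n x : `|x| = n.+1%:R -> `|F x - 0| * Num.sqrt n.+1%:R <= K.
    move=> xn; rewrite subr0.
    apply: (@le_trans _ _ (`|x - 0| * p x)).
      rewrite /F normrM (ger0_norm (normal_pdf_ge0 _ _ _)) subr0 xn mulrAC.
      rewrite ler_wpM2r ?normal_pdf_ge0// -[leRHS]mul1r ler_pM ?sqrtr_ge0 ?sin_max//.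
      rewrite -[leRHS]ger0_norm// -sqrtr_sqr ler_sqrt ?sqr_ge0//.
      by rewrite -natrX ler_nat leq_pmulr.
    apply: le_trans (normr_normal_pdf_le _ _ s0) _.
    rewrite !ler_wpM2l ?sqrtr_ge0//; apply: normal_pdf_ub.
    by rewrite mulf_neq0// gt_eqF// sqrtr_gt0.
  have f0 : \int[mu]_x f x = 0.
    apply: (@integral_derive_vanishing f F).
    - exact: (integrableB measurableT if1 if2).
    - move=> x; apply: cvgB; apply: cvgMr; apply: cvgM.
      + exact: continuous_cosB.
      + exact: continuous_normal_pdf.
      + exact: continuous_sinB.
      + apply: cvgM; first exact: cvg_id.
        exact: continuous_normal_pdf.
    - move=> x; have dp := is_derive_normal_pdf0 x s0.
      rewrite /F; apply: is_derive_eq.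
      rewrite /f /p /GRing.scale /= !(mulr1, mulr0, add0r, addr0, subr0, oppr0, scaler0).
      by field.
    - by apply: (@cvgn_sqrt_bound _ 0 K) => n; apply: (FK n n.+1%:R); rewrite ger0_norm.
    - by apply: (@cvgn_sqrt_bound _ 0 K) => n; apply: (FK n (- n.+1%:R)); rewrite normrN ger0_norm.
  move: f0; rewrite /f RintegralB// !RintegralZl// => /eqP; rewrite subr_eq0 => /eqP f0.
  by rewrite -mulrA f0 mulrA mulfV ?mul1r// expf_neq0.
have dPhi t' : is_derive t' 1 Phi (- (s ^+ 2 * t' * Phi t')).
  pose f u (x : measurableTypeR R) := cos (u * x - a) * p x.
  have df (u : R) (x : measurableTypeR R) : is_derive u 1 (fun u' : R => f u' x) (- sin (u * x - a) * (x * p x)).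
    rewrite /f; apply: is_derive_eq.
    rewrite /GRing.scale /= !(mulr1, mulr0, add0r, addr0, subr0, oppr0, scaler0).
    by ring.
  have exd (u : R) (x : measurableTypeR R) : derivable (fun u' : R => f u' x) u 1.
    by case: (df u x).
  have d1f (u : R) (x : measurableTypeR R) : partial1of2 f u x = - sin (u * x - a) * (x * p x).
    by rewrite partial1of2E; exact: derive_val.
  have I0 : t' \in `]t' - 1, t' + 1[ by rewrite in_itv/= ltrDl ltrBlDr ltrDl ltr01.
  have ub (u : R) (x : measurableTypeR R) : u \in `]t' - 1, t' + 1[ -> setT x -> `|partial1of2 f u x| <= `|x| * p x.
    move=> _ _; rewrite d1f normrM normrN -[leRHS]mul1r ler_pM ?sin_max//.
    by rewrite normrM (ger0_norm (normal_pdf_ge0 _ _ _)).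
  have G0 (x : measurableTypeR R) : 0 <= `|x| * p x by rewrite mulr_ge0 ?normal_pdf_ge0.
  have der := @derivable_under_integral R _ _ mu f setT measurableT t' (t' - 1) (t' + 1)
    I0 (fun u _ => icos u) (fun u x _ _ => exd u x) _ G0 ixp ub.
  have val := @differentiation_under_integral R _ _ mu f setT measurableT t' (t' - 1) (t' + 1)
    I0 (fun u _ => icos u) (fun u x _ _ => exd u x) _ G0 ixp ub.
  apply: DeriveDef => //.
  rewrite -parts -derive1E val.
  under eq_Rintegral do rewrite d1f mulNr -mulN1r.
  by rewrite RintegralZl// mulN1r.
have dconst (u : R) : is_derive u 1 (fun t' => Phi t' * expR (s ^+ 2 / 2 * t' ^+ 2)) 0.
  have dP := dPhi u.
  apply: is_derive_eq.
  rewrite /GRing.scale /= !(mulr1, mulr0, add0r, addr0).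
  by field.
have := @is_derive_0_is_cst R (fun t' => Phi t' * expR (s ^+ 2 / 2 * t' ^+ 2)) t 0 dconst.
rewrite expr0n /= mulr0 expR0 mulr1.
have -> : Phi 0 = cos a.
  rewrite /Phi; under eq_Rintegral do rewrite mul0r add0r cosN.
  by rewrite RintegralZl// /Rintegral integral_normal_pdf mulr1.
move=> <-; rewrite -[RHS]mulrA -expRD.
rewrite (_ : _ + _ = 0) ?expR0 ?mulr1//.
by field.
Qed.

End gaussian.

(** * Densities and mixtures *)

Section density_lemmas.
Context d (T : measurableType d) (R : realType).

Lemma Rintegral_density (nu : probability T R)
    (mu : {sigma_finite_measure set T -> \bar R}) (w f : T -> R) (M : R) :
  nu `<< mu -> mu.-integrable setT (EFin \o w) ->
  (forall A, measurable A -> nu A = (\int[mu]_(x in A) (w x)%:E)%E) ->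
  measurable_fun setT f -> (forall x, `|f x| <= M) ->
  \int[nu]_x f x = \int[mu]_x (f x * w x).
Proof.
move=> numu iw nuE mf fM; congr fine.
rewrite -(Radon_Nikodym_change_of_variables numu measurableT); last first.
  exact: bounded_integrable fM.
apply: ae_eq_integral => //.
- apply: emeasurable_funM; first exact/measurable_EFinP.
  by apply: measurable_int; exact: Radon_Nikodym_integrable.
- apply/measurable_EFinP; apply: measurable_funM => //.
  by move: iw => /measurable_int/measurable_EFinP.
- have /ae_eqe_mul2l : ae_eq mu setT
      (Radon_Nikodym (charge_of_finite_measure nu) mu) (EFin \o w).
    apply: integral_ae_eq => //.
    + exact: Radon_Nikodym_integrable.
    + exact: measurable_int iw.
    + by move=> A _ mA; rewrite -Radon_Nikodym_integral// -nuE.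
  exact.
Qed.
End density_lemmas.

Section mixtures.
Context d (T : measurableType d) d' (T' : measurableType d') (R : realType).
Variable mu : {sigma_finite_measure set T' -> \bar R}.

Let bounded_section_integrable (P : probability T R) (K : T * T' -> R) (C : R) y :
  measurable_fun setT K -> (forall z, `|K z| <= C) ->
  P.-integrable setT (EFin \o (fun x => K (x, y))).
Proof.
move=> mK KC; apply: (@bounded_integrable _ _ _ _ _ C) => //.
exact: measurableT_comp mK (pair2_measurable y).
Qed.

Let integrable_mixture (P : probability T R) (K : T * T' -> R) (W : T' -> R) (C : R) :
  measurable_fun setT K -> (forall z, `|K z| <= C) ->
  mu.-integrable setT (EFin \o W) ->
  (P \x mu)%E.-integrable setT (EFin \o (fun z => K z * W z.2)).
Proof.
move=> mK KC iW.
have mW : measurable_fun setT W by move: iW => /measurable_int/measurable_EFinP.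
have mKW : measurable_fun setT (fun z : T * T' => K z * W z.2).
  by apply: measurable_funM => //; exact: measurableT_comp.
have mA : measurable_fun setT (abse \o (EFin \o (fun z : T * T' => K z * W z.2))).
  by apply: measurableT_comp => //; exact/measurable_EFinP.
apply/integrable12ltyP; first exact/measurable_EFinP.
have iCW : mu.-integrable setT (EFin \o (fun y => C * `|W y|)).
  exact: (integrableZl measurableT C (integrable_norm iW)).
apply: (@le_lt_trans _ _ (\int[P]_x (\int[mu]_y (C * `|W y|)%:E))%E).
  apply: ge0_le_integral => //.
  - by move=> x _; exact: integral_ge0.
  - apply: (@measurable_fun_fubini_tonelli_F _ _ _ _ _ _ (abse \o (EFin \o (fun z => K z * W z.2)))) => //.
    by move=> z; exact: abse_ge0.
  - move=> x _; apply: ge0_le_integral => //.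
    + exact: measurableT_comp mA (pair1_measurable x).
    + exact: measurable_int iCW.
    + by move=> y _ /=; rewrite lee_fin normrM ler_wpM2r.
rewrite integral_cst// [X in (_ * X)%E]probability_setT mule1.
exact: integrable_lty iCW.
Qed.

Let section_integral (P : probability T R) (K : T * T' -> R) (W : T' -> R) (C : R) y :
  measurable_fun setT K -> (forall z, `|K z| <= C) ->
  (\int[P]_x (K (x, y) * W y)%:E)%E = ((\int[P]_x K (x, y)) * W y)%:E.
Proof.
move=> mK KC; have iK := bounded_section_integrable P y mK KC.
rewrite -RintegralZr// fineK//; apply: integrable_fin_num => //.
exact: (integrableZr measurableT (W y) iK).
Qed.

Lemma Rintegral_mixture (P : probability T R) (K : T * T' -> R) (W : T' -> R) (C : R) :
  measurable_fun setT K -> (forall z, `|K z| <= C) ->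
  mu.-integrable setT (EFin \o W) ->
  \int[P]_x \int[mu]_y (K (x, y) * W y) =
  \int[mu]_y ((\int[P]_x K (x, y)) * W y).
Proof.
move=> mK KC iW; have iKW := integrable_mixture P mK KC iW.
have E1 x : mu.-integrable setT (EFin \o (fun y => K (x, y) * W y)).
  apply: (@integrable_boundedM _ _ _ _ _ _ C) => //.
  exact: measurableT_comp mK (pair1_measurable x).
transitivity (fine (\int[P]_x \int[mu]_y (K (x, y) * W y)%:E)).
  congr fine; apply: eq_integral => x _; rewrite /= fineK//.
  exact: integrable_fin_num (E1 x).
rewrite (Fubini iKW); congr fine.
by apply: eq_integral => y _; exact: section_integral KC.
Qed.

Lemma measurable_mixture (P : probability T R) (K : T * T' -> R) (W : T' -> R)
    (C : R) :
  measurable_fun setT K -> (forall z, `|K z| <= C) ->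
  mu.-integrable setT (EFin \o W) ->
  measurable_fun setT (fun x => \int[mu]_y (K (x, y) * W y)).
Proof.
move=> mK KC iW; apply/measurable_EFinP.
have mF := measurable_fubini_F (integrable_mixture P mK KC iW).
apply: eq_measurable_fun mF => x _; rewrite /= fineK//.
apply: integrable_fin_num => //.
apply: (@integrable_boundedM _ _ _ _ _ _ C) => //.
exact: measurableT_comp mK (pair1_measurable x).
Qed.

(** Fubini moves the integral over [y] outside; for each [y] the inner integrals converge and stay
    below [C] in absolute value, so [C * |W y|] is a majorant. *)
Lemma cvg_mixture (P_ : nat -> probability T R) (P : probability T R)
    (K : T * T' -> R) (W : T' -> R) (C : R) :
  measurable_fun setT K -> (forall z, `|K z| <= C) ->
  mu.-integrable setT (EFin \o W) ->
  (forall y, \int[P_ n]_x K (x, y) @[n --> \oo] --> \int[P]_x K (x, y)) ->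
  \int[P_ n]_x \int[mu]_y (K (x, y) * W y) @[n --> \oo] -->
  \int[P]_x \int[mu]_y (K (x, y) * W y).
Proof.
move=> mK KC iW PK.
rewrite (Rintegral_mixture P mK KC iW).
under eq_fun do rewrite (Rintegral_mixture _ mK KC iW).
have mW : measurable_fun setT W by move: iW => /measurable_int/measurable_EFinP.
apply: (@dominated_cvg_Rintegral _ _ _ _ _ _ (fun y => C * `|W y|)).
- move=> n; apply/measurable_EFinP.
  have mG := measurable_fubini_G (integrable_mixture (P_ n) mK KC iW).
  apply: eq_measurable_fun mG => y _.
  exact: section_integral KC.
- by move=> y; apply: cvgM => //; exact: cvg_cst.
- move=> n y; rewrite normrM ler_wpM2r//.
  have iK := bounded_section_integrable (P_ n) y mK KC.
  apply: le_trans (le_normr_Rintegral _ iK) _ => //.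
  have -> : C = \int[P_ n]_x C.
    by rewrite Rintegral_cst// [X in fine X]probability_setT mulr1.
  apply: le_Rintegral => //; first exact: (integrable_norm iK).
  exact: finite_measure_integrable_cst.
- exact: (integrableZl measurableT C (integrable_norm iW)).
Qed.
End mixtures.

(** * Weak convergence from trigonometric integrals *)

Section weak_convergence.
Context (R : realType).
Notation RM := (measurableTypeR R).
Notation mu := (@lebesgue_measure R).
Variables (P_ : nat -> probability RM R) (P : probability RM R).

Lemma cvg_uniform_approx (g : RM -> R) (M : R) :
  measurable_fun setT g -> (forall x, `|g x| <= M) ->
  (forall e, 0 < e -> exists h : RM -> R,
    [/\ measurable_fun setT h, (forall x, `|g x - h x| <= e) &
        \int[P_ n]_x h x @[n --> \oo] --> \int[P]_x h x]) ->
  \int[P_ n]_x g x @[n --> \oo] --> \int[P]_x g x.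
Proof.
move=> mg gM app; apply/cvgrPdist_le => e e0.
have e3 : 0 < e / 3 by rewrite divr_gt0.
have [h [mh gh ch]] := app _ e3.
have hM x : `|h x| <= M + e / 3.
  rewrite -[h x](subKr (g x)) (le_trans (ler_normB _ _))//.
  by rewrite lerD.
have gh' (Q : probability RM R) : `|\int[Q]_x g x - \int[Q]_x h x| <= e / 3.
  have ig := bounded_integrable Q mg gM.
  have ih := bounded_integrable Q mh hM.
  rewrite -RintegralB//.
  have mgh : measurable_fun setT (fun x => g x - h x) by exact: measurable_funB.
  have igh := bounded_integrable Q mgh gh.
  apply: le_trans (le_normr_Rintegral _ igh) _ => //.
  have -> : e / 3 = \int[Q]_x (e / 3).
    by rewrite Rintegral_cst// [X in fine X]probability_setT mulr1.
  apply: le_Rintegral => //; first exact: (integrable_norm igh).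
  exact: finite_measure_integrable_cst.
near=> n.
have hn : `|\int[P]_x h x - \int[P_ n]_x h x| <= e / 3.
  by near: n; move/cvgrPdist_le : ch; exact.
have g1 := gh' P; have g2 := gh' (P_ n).
rewrite !ler_norml in hn g1 g2 *; lra.
Unshelve. all: end_near. Qed.

(** Near-covering compactness of [-B, B] gives one radius for all its points. A pair meeting the
    segment is handled by symmetry, and outside it both values are 0. *)
Lemma continuous_supp_modulus (g : R -> R) (B : R) : continuous g ->
  (forall x, B < `|x| -> g x = 0) ->
  forall e, 0 < e -> exists2 r, 0 < r &
    forall x y, `|x - y| < r -> `|g x - g y| <= e.
Proof.
move=> cg gB e e0.
have := @segment_compact R (- B) B => /compact_near_coveringP.
move=> /(_ R (0 : R)^'+ (fun r x => forall y, `|x - y| < r -> `|g x - g y| <= e)).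
have loc x : `[- B, B]%classic x ->
    \forall x' \near x & r \near (0:R)^'+, forall y, `|x' - y| < r -> `|g x' - g y| <= e.
  move=> _; have e2 : 0 < e / 2 by rewrite divr_gt0.
  have /cvgrPdist_le/(_ _ e2)[r /= r0 gr] := cg x.
  exists (ball x (r / 2), [set t | t < r / 2]).
    split => /=.
      by apply: nbhsx_ballx; rewrite divr_gt0.
    by apply: nbhs_right_lt; rewrite divr_gt0.
  move=> [x' t] [/= xx' tr] y x'y; rewrite /ball/= in xx'.
  have g1 : `|g x - g x'| <= e / 2.
    by apply: gr; rewrite /= (lt_trans xx')// ltr_pdivrMr// ltr_pMr// ltr1n.
  have g2 : `|g x - g y| <= e / 2.
    apply: gr => /=; have := lt_trans x'y tr.
    by move: xx'; rewrite !ltr_norml; lra.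
  by move: g1 g2; rewrite !ler_norml; lra.
move=> /(_ _ loc) h.
have : \forall r \near (0:R)^'+, 0 < r /\ (`[- B, B]%classic `<=`
  (fun x => forall y : R, `|x - y| < r -> `|g x - g y| <= e)).
  near=> r; split; near: r; [exact: nbhs_right_gt|exact: h].
move=> /filter_ex [r [r0 gr]]; exists r => // x y xy.
have [xB|xB] := leP `|x| B.
  by apply: gr => //=; rewrite in_itv/= -ler_norml.
have [yB|yB] := leP `|y| B.
  by rewrite distrC; apply: gr; rewrite 1?distrC//= in_itv/= -ler_norml.
by rewrite !gB// subrr normr0 ltW.
Unshelve. all: end_near. Qed.

Hypothesis cvg_cos : forall t a : R,
  \int[P_ n]_x cos (t * x - a) @[n --> \oo] --> \int[P]_x cos (t * x - a).

(** A Gaussian is its own Fourier transform: [normal_char] with deviation [s^-1] writes the bump as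
    a mixture of [cos (u x - u y)] over [u]. The integration variable sits in the place of the mean,
    which is harmless because the density is symmetric in [x] and [y]. *)
Lemma cvg_normal_pdf (s y : R) : s != 0 ->
  \int[P_ n]_x normal_pdf x s y @[n --> \oo] --> \int[P]_x normal_pdf x s y.
Proof.
move=> s0; have s'0 : s^-1 != 0 by rewrite invr_eq0.
have E x : normal_pdf x s y =
    normal_peak s * \int[mu]_u (cos (u * x - u * y) * normal_pdf 0 s^-1 u).
  rewrite normal_pdfE//; congr (_ * _).
  transitivity (\int[mu]_u (cos ((x - y) * u - 0) * normal_pdf 0 s^-1 u)); last first.
    by apply: eq_Rintegral => u _; rewrite subr0 [_ * u]mulrC mulrBr.
  rewrite normal_char// cos0 mul1r; congr expR.
  by field.
pose K (z : RM * RM) := cos (z.2 * z.1 - z.2 * y).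
have mK : measurable_fun setT K.
  have m1 : @measurable_fun _ _ _ R setT (fun z : RM * RM => z.1) := measurable_fst.
  have m2 : @measurable_fun _ _ _ R setT (fun z : RM * RM => z.2) := measurable_snd.
  apply: (measurableT_comp (continuous_measurable_fun (@continuous_cos R))).
  by apply: measurable_funB; apply: measurable_funM.
have iW := integrable_normal_pdf 0 s^-1.
have K1 z : `|K z| <= 1 := cos_max _.
have iK (Q : probability RM R) : Q.-integrable setT
    (EFin \o (fun x => \int[mu]_u (K (x, u) * normal_pdf 0 s^-1 u))).
  apply: (@bounded_integrable _ _ _ _ _ 1).
    have := @measurable_mixture _ RM _ RM R mu Q K (normal_pdf 0 s^-1) 1 mK K1 iW.
    exact.
  move=> x; rewrite -[leRHS]mulr1.
  rewrite -[X in _ <= 1 * X](_ : \int[mu]_u `|normal_pdf 0 s^-1 u| = 1).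
    apply: le_norm_Rintegral_boundedM => //.
    exact: measurableT_comp mK (pair1_measurable x).
  under eq_Rintegral do rewrite ger0_norm ?normal_pdf_ge0//.
  by rewrite /Rintegral integral_normal_pdf.
pose J x := \int[mu]_u (K (x, u) * normal_pdf 0 s^-1 u).
have EQ (Q : probability RM R) :
    \int[Q]_x normal_pdf x s y = normal_peak s * \int[Q]_x J x.
  rewrite -(RintegralZl _ measurableT (iK Q)).
  by apply: eq_Rintegral => x _; exact: E.
rewrite EQ; under eq_fun do rewrite EQ.
apply: cvgM; first exact: cvg_cst.
exact: (@cvg_mixture _ RM _ RM R mu P_ P K (normal_pdf 0 s^-1) 1 mK K1 iW
  (fun u => @cvg_cos u (u * y))).
Qed.

(** Within [r] of [x] the function moves by at most [e]. Beyond, its variation is at most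
    [2 M (y - x)^2 / r^2], and [4 s^2 sqrt 2] is the bound on the second moment that
    [sqr_normal_pdf_le] gives after integration. *)
Lemma mollified_close (g : R -> R) (M r e s x : R) :
  continuous g -> (forall x, `|g x| <= M) -> 0 < r -> 0 < s ->
  (forall x y, `|x - y| < r -> `|g x - g y| <= e) ->
  `|g x - \int[mu]_y (normal_pdf x s y * g y)| <=
  e + 2 * M / r ^+ 2 * (4 * s ^+ 2 * Num.sqrt 2).
Proof.
move=> cg gM r0 s0' gr; have s0 : s != 0 by rewrite gt_eqF.
have M0 : 0 <= M := le_trans (normr_ge0 _) (gM 0).
have e0 : 0 <= e by rewrite -(@normr0 _ R) -[X in `|X|](subrr (g 0)) gr// subrr normr0.
have mg := continuous_measurable_funTR cg.
have ip := integrable_normal_pdf x s.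
pose s2 := Num.sqrt 2 * s.
have ip2 := integrable_normal_pdf x s2.
have iZ c : mu.-integrable setT (EFin \o (fun y : RM => c * normal_pdf x s y)).
  exact: (integrableZl measurableT c ip).
have iZ2 c : mu.-integrable setT (EFin \o (fun y : RM => c * normal_pdf x s2 y)).
  exact: (integrableZl measurableT c ip2).
have igp : mu.-integrable setT (EFin \o (fun y : RM => g y * normal_pdf x s y)).
  exact: integrable_boundedM mg gM ip.
have -> : g x - \int[mu]_y (normal_pdf x s y * g y) =
    \int[mu]_y (g x * normal_pdf x s y - g y * normal_pdf x s y).
  rewrite RintegralB// RintegralZl//.
  rewrite {2}/Rintegral integral_normal_pdf mulr1; congr (_ - _).
  by apply: eq_Rintegral => y _; rewrite mulrC.
have id : mu.-integrable setT (EFin \o (fun y : RM => g x * normal_pdf x s y - g y * normal_pdf x s y)).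
  exact: (integrableB measurableT (iZ (g x)) igp).
apply: le_trans (le_normr_Rintegral _ id) _ => //.
pose c := 2 * M / r ^+ 2 * (4 * s ^+ 2 * Num.sqrt 2).
have -> : e + c = \int[mu]_y (e * normal_pdf x s y + c * normal_pdf x s2 y).
  rewrite RintegralD// !RintegralZl//.
  by rewrite /Rintegral !integral_normal_pdf !mulr1.
apply: le_Rintegral => //.
- exact: (integrable_norm id).
- exact: (integrableD measurableT (iZ e) (iZ2 c)).
move=> y _; rewrite -mulrBl normrM (ger0_norm (normal_pdf_ge0 _ _ _)).
apply: (@le_trans _ _ ((e + 2 * M / r ^+ 2 * (y - x) ^+ 2) * normal_pdf x s y)).
  rewrite ler_wpM2r ?normal_pdf_ge0//.
  have [xy|xy] := ltP `|x - y| r.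
    by rewrite (le_trans (gr _ _ xy))// lerDl mulr_ge0 ?sqr_ge0// divr_ge0 ?sqr_ge0// mulr_ge0.
  rewrite -[leLHS]add0r lerD// (@le_trans _ _ (2 * M))//.
    rewrite (le_trans (ler_normB _ _))//.
    by have := gM x; have := gM y; lra.
  rewrite -mulrA ler_peMr ?mulr_ge0// mulrC ler_pdivlMr ?exprn_gt0// mul1r.
  rewrite -[leRHS]real_normK ?num_real// distrC.
  by apply: lerXn2r => //; rewrite nnegrE ltW.
rewrite mulrDl lerD2l -[leLHS]mulrA -[leRHS]mulrA ler_wpM2l ?divr_ge0 ?mulr_ge0 ?sqr_ge0 ?(ltW r0)//.
by rewrite -[leRHS]mulrA sqr_normal_pdf_le.
Qed.

(** Smoothing by a narrow Gaussian is uniformly close to [g], and the smoothed function is a mixture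
    of bumps with weight [g] itself; compact support makes this weight Lebesgue integrable. *)
Lemma cvg_compact_support (g : R -> R) (M B : R) : continuous g ->
  (forall x, `|g x| <= M) -> (forall x, B < `|x| -> g x = 0) ->
  \int[P_ n]_x g x @[n --> \oo] --> \int[P]_x g x.
Proof.
move=> cg gM gB; have mg := continuous_measurable_funTR cg.
apply: (@cvg_uniform_approx _ M) => // e e0.
have e2 : 0 < e / 2 by rewrite divr_gt0.
have [r r0 gr] := continuous_supp_modulus cg gB e2.
have M0 : 0 <= M := le_trans (normr_ge0 _) (gM 0).
pose c := 2 * M / r ^+ 2 * (4 * Num.sqrt 2).
have c0 : 0 <= c by rewrite mulr_ge0 ?divr_ge0 ?mulr_ge0 ?sqr_ge0 ?(ltW r0)//.
(* The width that brings the smoothing error below [e / 2]; [c + 1] keeps the quotient meaningful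
   when [c] is 0. *)
have [s s0 cs] : exists2 s, 0 < s & c * s ^+ 2 <= e / 2.
  exists (Num.sqrt (e / 2 / (c + 1))).
    by rewrite sqrtr_gt0 divr_gt0// ltr_wpDl.
  rewrite sqr_sqrtr; last by rewrite divr_ge0 ?(ltW e2)// addr_ge0.
  rewrite mulrCA ler_piMr ?(ltW e2)// ler_pdivrMr ?ltr_wpDl// mul1r lerDl//.
have ig : mu.-integrable setT (EFin \o (g : RM -> R)).
  have ib := @integrable_indic_itv R (- B) B true false.
  have := integrable_boundedM mg gM ib.
  apply: eq_integrable => // x _ /=; congr EFin.
  rewrite indicE; have [xB|xB] := leP `|x| B.
    by rewrite mem_set ?mulr1//= in_itv/= -ler_norml.
  by rewrite gB// mul0r.
pose K (z : RM * RM) := normal_pdf z.1 s z.2.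
have s0' : s != 0 by rewrite gt_eqF.
have mK : measurable_fun setT K.
  have m1 : @measurable_fun _ _ _ R setT (fun z : RM * RM => z.1) := measurable_fst.
  have m2 : @measurable_fun _ _ _ R setT (fun z : RM * RM => z.2) := measurable_snd.
  rewrite /K; under eq_fun do rewrite normal_pdfE//.
  apply: measurable_funM => //.
  apply: (measurableT_comp (continuous_measurable_fun (@continuous_expR R))).
  apply: measurable_funM => //; apply: measurableT_comp => //.
  by apply: measurable_funX; exact: measurable_funB.
have KM z : `|K z| <= normal_peak s.
  by rewrite ger0_norm ?normal_pdf_ge0// normal_pdf_ub.
exists (fun x => \int[mu]_y (K (x, y) * g y)); split.
- exact: (@measurable_mixture _ RM _ RM R mu P K g _ mK KM ig).
- move=> x; apply: (le_trans (mollified_close x cg gM r0 s0 gr)).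
  have -> : 2 * M / r ^+ 2 * (4 * s ^+ 2 * Num.sqrt 2) = c * s ^+ 2 by rewrite /c; ring.
  by lra.
- exact: (@cvg_mixture _ RM _ RM R mu P_ P K g _ mK KM ig
    (fun y => @cvg_normal_pdf s y s0')).
Qed.

(** Tightness comes from the cut-off: [th L], a trapezoid equal to 1 on [-L, L] and 0 off
    [-L - 1, L + 1], has compact support, so its integrals converge. If [P] misses little mass under
    it, so do the [P_ n] eventually, and replacing [g] by [th L * g] costs at most [M] times the
    missing mass. *)
Lemma cvg_bounded_continuous (g : R -> R) (M : R) : continuous g ->
  (forall x, `|g x| <= M) ->
  \int[P_ n]_x g x @[n --> \oo] --> \int[P]_x g x.
Proof.
move=> cg gM; have mg := continuous_measurable_funTR cg.
have M0 : 0 <= M := le_trans (normr_ge0 _) (gM 0).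
pose th (L x : R) := Num.max 0 (Num.min 1 (L + 1 - `|x|)).
have th01 L x : 0 <= th L x <= 1.
  by rewrite /th le_max lexx /= ge_max ler01 ge_min lexx.
have thn L x : `|th L x| <= 1.
  by rewrite ger0_norm; have /andP[] := th01 L x.
have th0 L x : L + 1 < `|x| -> th L x = 0.
  by move=> Lx; rewrite /th min_r ?max_l//; lra.
have th1 L x : `|x| <= L -> th L x = 1.
  by move=> Lx; rewrite /th min_l ?max_r//; lra.
have cth L : continuous (th L).
  move=> x; apply: (@continuous_max R R (fun=> 0) (fun y => Num.min 1 (L + 1 - `|y|))).
    exact: cvg_cst.
  apply: (@continuous_min R R (fun=> 1) (fun y => L + 1 - `|y|)).
    exact: cvg_cst.
  by apply: cvgB; [exact: cvg_cst|exact: norm_continuous].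
have mth L := continuous_measurable_funTR (cth L).
have cgth L : continuous (fun x => th L x * g x).
  by move=> x; apply: cvgM; [exact: cth|exact: cg].
have mgth L := continuous_measurable_funTR (cgth L).
have gthM L x : `|th L x * g x| <= M.
  by rewrite normrM -[leRHS]mul1r ler_pM.
have ct L : \int[P_ n]_x th L x @[n --> \oo] --> \int[P]_x th L x.
  exact: (cvg_compact_support (cth L) (thn L) (th0 L)).
have cgt L : \int[P_ n]_x (th L x * g x) @[n --> \oo] --> \int[P]_x (th L x * g x).
  apply: (@cvg_compact_support _ M (L + 1) (cgth L) (gthM L)).
  by move=> x Lx; rewrite th0// mul0r.
have cut (Q : probability RM R) L :
    `|\int[Q]_x g x - \int[Q]_x (th L x * g x)| <= M * (1 - \int[Q]_x th L x).
  have ig := bounded_integrable Q mg gM.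
  have ith := bounded_integrable Q (mth L) (thn L).
  have igth := bounded_integrable Q (mgth L) (gthM L).
  have i1 := finite_measure_integrable_cst Q (1 : R) measurableT.
  rewrite -RintegralB//.
  have -> : 1 - \int[Q]_x th L x = \int[Q]_x (1 - th L x).
    by rewrite RintegralB// Rintegral_cst// [X in fine X]probability_setT mulr1.
  have i1th : Q.-integrable setT (EFin \o (fun x : RM => 1 - th L x)).
    exact: (integrableB measurableT i1 ith).
  have id : Q.-integrable setT (EFin \o (fun x : RM => g x - th L x * g x)).
    exact: (integrableB measurableT ig igth).
  rewrite -RintegralZl//.
  apply: le_trans (le_normr_Rintegral _ id) _ => //.
  apply: le_Rintegral => //; first exact: (integrable_norm id).
    exact: (integrableZl measurableT M i1th).
  move=> x _; rewrite -{1}[g x]mul1r -mulrBl normrM mulrC ler_pM//.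
  by rewrite ger0_norm// subr_ge0; have /andP[] := th01 L x.
apply/cvgrPdist_le => e e0.
(* Error budget: [M e'] for the cut under [P], [2 M e'] for the cut under [P_ n], and [e / 4] for
   the convergence of the truncated integrals; [M + 1] guards against [M = 0]. *)
pose e' := e / (4 * (M + 1)).
have e'0 : 0 < e' by rewrite divr_gt0// mulr_gt0// ltr_wpDl.
have Me' : 4 * (M * e') <= e.
  rewrite /e' mulrA mulrA -mulrA.
  have -> : 4 * M * (e / (4 * (M + 1))) = e * (M / (M + 1)).
    by field; rewrite gt_eqF// ltr_wpDl.
  by rewrite ler_piMr ?(ltW e0)// ler_pdivrMr ?ltr_wpDl// mul1r lerDl.
have [L tL] : exists L, 1 - \int[P]_x th L x <= e'.
  have : \int[P]_x th n%:R x @[n --> \oo] --> \int[P]_x (1 : R).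
    apply: (@dominated_cvg_Rintegral _ RM R P (fun n x => th n%:R x) (fun=> 1) (fun=> 1)).
    - by move=> n; exact: mth.
    - move=> x; apply: cvg_near_cst; exists (Num.truncn `|x|).+1 => // n /= xn.
      by apply: th1; rewrite (le_trans (ltW (truncnS_gt _)))// ler_nat.
    - by move=> n x; exact: thn.
    - exact: finite_measure_integrable_cst.
  rewrite Rintegral_cst// [X in fine X]probability_setT mulr1.
  move=> /cvgrPdist_le/(_ _ e'0)[N _ /(_ N (leqnn N))] /= h.
  by exists N%:R; rewrite (le_trans (ler_norm _)).
have eM : 0 < e / 4 by rewrite divr_gt0.
near=> n.
have t1 : `|\int[P]_x th L x - \int[P_ n]_x th L x| <= e'.
  by near: n; move/cvgrPdist_le : (ct L); exact.
have t2 : `|\int[P]_x (th L x * g x) - \int[P_ n]_x (th L x * g x)| <= e / 4.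
  by near: n; move/cvgrPdist_le : (cgt L); exact.
have c1 := cut P L; have c2 := cut (P_ n) L.
have u1 : M * (1 - \int[P]_x th L x) <= M * e' by rewrite ler_wpM2l.
have u2 : M * (1 - \int[P_ n]_x th L x) <= M * (2 * e').
  by rewrite ler_wpM2l//; move: t1; rewrite ler_norml; lra.
rewrite !ler_norml in t2 c1 c2 *; lra.
Unshelve. all: end_near. Qed.
End weak_convergence.

Lemma Rintegral_cos_normal (R : realType) (s t a : R) : s != 0 ->
  \int[normal_prob 0 s]_x cos (t * x - a) = cos a * expR (- ((s * t) ^+ 2 / 2)).
Proof.
move=> s0; rewrite -normal_char//.
apply: (@Rintegral_density _ (measurableTypeR R) R (normal_prob 0 s)
  lebesgue_measure (normal_pdf 0 s) (fun x => cos (t * x - a)) 1).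
- exact: normal_prob_dominates.
- exact: integrable_normal_pdf.
- by [].
- by apply: continuous_measurable_funTR; exact: continuous_cosB.
- by move=> x; exact: cos_max.
Qed.

(** * Taylor estimates and Birkhoff sums *)

Section taylor.
Context (R : realType).

(** The mean value theorem trades a derivative for one factor [b]. In the three Taylor bounds below,
    each remainder has the previous one as its derivative up to sign, so they follow in turn,
    without factorials. *)
Lemma norm_le_expr_derive (f f' : R -> R) (k : nat) (b : R) : f 0 = 0 ->
  (forall x : R, is_derive x 1 f (f' x)) -> (forall x, `|f' x| <= `|x| ^+ k) ->
  `|f b| <= `|b| ^+ k.+1.
Proof.
move=> f0 df f'k.
have cf : continuous f.
  by move=> x; apply/differentiable_continuous/derivable1_diffP; case: (df x).
have [c cb fE] : exists2 c, `|c| <= `|b| & f b = f' c * b.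
  have [b0|b0|b0] := ltgtP b 0.
  - have [c c0b] := @MVT R f f' b 0 b0 (fun x _ => df x) (continuous_subspaceT cf).
    move: c0b; rewrite in_itv/= f0 !sub0r mulrN => /andP[bc c0] /oppr_inj fE.
    by exists c => //; rewrite !ltr0_norm// lerN2 ltW.
  - have [c c0b] := @MVT R f f' 0 b b0 (fun x _ => df x) (continuous_subspaceT cf).
    move: c0b; rewrite in_itv/= f0 !subr0 => /andP[c0 bc] fE.
    by exists c => //; rewrite !gtr0_norm// ltW.
  - by exists 0; rewrite ?b0// f0 mulr0.
rewrite fE normrM exprSr ler_wpM2r// (le_trans (f'k c))//.
by rewrite lerXn2r ?nnegrE.
Qed.

Lemma cosD_taylor0 (z b : R) : `|cos (z + b) - cos z| <= `|b|.
Proof.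
rewrite -[leRHS]expr1.
apply: (@norm_le_expr_derive (fun b => cos (z + b) - cos z) (fun b => - sin (z + b))).
- by rewrite addr0 subrr.
- move=> x; apply: is_derive_eq.
  by rewrite /GRing.scale /= !(mulr1, mul1r, add0r, addr0, subr0, oppr0).
- by move=> x; rewrite normrN expr0 sin_max.
Qed.

Lemma sinD_taylor1 (z b : R) : `|sin (z + b) - sin z - b * cos z| <= `|b| ^+ 2.
Proof.
apply: (@norm_le_expr_derive (fun b => sin (z + b) - sin z - b * cos z)
  (fun b => cos (z + b) - cos z)).
- by rewrite addr0 mul0r !subrr.
- move=> x; apply: is_derive_eq.
  by rewrite /GRing.scale /= !(mulr1, mul1r, mulr0, add0r, addr0, subr0, oppr0).
- by move=> x; rewrite expr1 cosD_taylor0.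
Qed.

Lemma cosD_taylor2 (z b : R) :
  `|cos (z + b) - (cos z - b * sin z - b ^+ 2 / 2 * cos z)| <= `|b| ^+ 3.
Proof.
apply: (@norm_le_expr_derive
  (fun b => cos (z + b) - (cos z - b * sin z - b ^+ 2 / 2 * cos z))
  (fun b => - (sin (z + b) - sin z - b * cos z))).
- by rewrite addr0; ring.
- move=> x; apply: is_derive_eq.
  rewrite /GRing.scale /= !(mulr1, mul1r, mulr0, add0r, addr0, subr0, oppr0).
  by field.
- by move=> x; rewrite normrN sinD_taylor1.
Qed.

(** Both sides come from [1 + y <= expR y]: taken at [-x], and inverted at [x]. *)
Lemma expRN_taylor1 (x : R) : 0 <= x -> `|expR (- x) - (1 - x)| <= x ^+ 2.
Proof.
move=> x0; have x1 : 0 < 1 + x by rewrite ltr_pwDl.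
have lb := expR_ge1Dx (- x).
have ub : expR (- x) <= (1 + x)^-1.
  by rewrite expRN lef_pV2 ?posrE ?expR_gt0// expR_ge1Dx.
rewrite ger0_norm ?subr_ge0// lerBlDr (le_trans ub)//.
rewrite -[leLHS]mul1r ler_pdivrMr//.
have x3 : 0 <= x ^+ 3 by rewrite exprn_ge0.
have -> : (x ^+ 2 + (1 - x)) * (1 + x) = 1 + x ^+ 3 by ring.
by rewrite lerDl.
Qed.

(** Earlier errors are multiplied by powers of [q <= 1], hence never amplified, and the n defects
    simply add up. *)
Lemma norm_recurrence_le (q c : R) (u : nat -> R) n : 0 <= q <= 1 ->
  (forall k, `|u k.+1 - q * u k| <= c) -> `|u n - q ^+ n * u 0%N| <= n%:R * c.
Proof.
move=> /andP[q0 q1] uc; have c0 : 0 <= c := le_trans (normr_ge0 _) (uc 0%N).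
elim: n => [|n ih]; first by rewrite expr0 mul1r subrr normr0 mul0r.
have -> : u n.+1 - q ^+ n.+1 * u 0%N =
    (u n.+1 - q * u n) + q * (u n - q ^+ n * u 0%N) by rewrite exprS; ring.
rewrite (le_trans (ler_normD _ _))// -natr1 mulrDl mul1r [leRHS]addrC lerD//.
by rewrite normrM ger0_norm// (le_trans _ ih)// ler_piMl.
Qed.
End taylor.

Lemma birkhoff_sumS (X : Type) (R : realType) (T : X -> X) (phi : X -> R) n x :
  birkhoff_sum T phi n.+1 x = phi x + birkhoff_sum T phi n (T x).
Proof.
rewrite /birkhoff_sum big_ord_recl; congr (_ + _).
by apply: eq_bigr => i _; rewrite -iterSr.
Qed.

(** Only the end terms differ, so the sums are invariant under [T] up to a bound independent of [n].
    This keeps the correction to the variance bounded and makes the limit insensitive to the initial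
    density. *)
Lemma birkhoff_sum_shift (X : Type) (R : realType) (T : X -> X) (phi : X -> R) n x :
  birkhoff_sum T phi n (T x) - birkhoff_sum T phi n x = phi (iter n T x) - phi x.
Proof.
have := birkhoff_sumS T phi n x; rewrite {1}/birkhoff_sum big_ord_recr /= -/(birkhoff_sum _ _ _ _).
by move/eqP; rewrite addrC -subr_eq => /eqP; lra.
Qed.

(** * The limit theorem for a class of functions stable under the Poisson equation *)

Definition bounded_measurable d (X : measurableType d) (R : realType)
    (G : X -> R) : Prop :=
  measurable_fun setT G /\ exists M, forall x, `|G x| <= M.

Section pairing.
Context d (X : measurableType d) (R : realType) (m : probability X R).
Implicit Types G r : X -> R.
Notation integrable r := (m.-integrable setT (EFin \o r)).

Definition pairing G r := \int[m]_x (G x * r x).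
Definition L1norm r := \int[m]_x `|r x|.

Lemma L1norm_ge0 r : 0 <= L1norm r.
Proof. by apply: Rintegral_ge0 => x _; exact: normr_ge0. Qed.

Lemma bounded_measurable_integrable G r : bounded_measurable G -> integrable r ->
  integrable (fun x => G x * r x).
Proof. by move=> [mG [M GM]] ir; exact: integrable_boundedM mG GM ir. Qed.

Lemma norm_pairing_le G r M : measurable_fun setT G -> (forall x, `|G x| <= M) ->
  integrable r -> `|pairing G r| <= M * L1norm r.
Proof. by move=> mG GM ir; exact: le_norm_Rintegral_boundedM. Qed.

Lemma bounded_measurableZ c G : bounded_measurable G ->
  bounded_measurable (fun x => c * G x).
Proof.
move=> [mG [M GM]]; split; first exact: measurable_funM.
by exists (`|c| * M) => x; rewrite normrM ler_wpM2l.
Qed.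

Lemma bounded_measurableD G G' : bounded_measurable G -> bounded_measurable G' ->
  bounded_measurable (fun x => G x + G' x).
Proof.
move=> [mG [M GM]] [mG' [M' GM']]; split; first exact: measurable_funD.
by exists (M + M') => x; rewrite (le_trans (ler_normD _ _))// lerD.
Qed.

Lemma bounded_measurableM G G' : bounded_measurable G -> bounded_measurable G' ->
  bounded_measurable (fun x => G x * G' x).
Proof.
move=> [mG [M GM]] [mG' [M' GM']]; split; first exact: measurable_funM.
by exists (M * M') => x; rewrite normrM ler_pM.
Qed.

Lemma bounded_measurable_cst c : bounded_measurable (fun _ : X => c : R).
Proof. by split; [exact: measurable_cst|exists `|c|]. Qed.

Lemma bounded_measurable_comp G (T : X -> X) : measurable_fun setT T ->
  bounded_measurable G -> bounded_measurable (G \o T).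
Proof.
move=> mT [mG [M GM]]; split; first exact: measurableT_comp.
by exists M => x; exact: GM.
Qed.

Lemma pairingDr G r r' : bounded_measurable G -> integrable r -> integrable r' ->
  pairing G (fun x => r x + r' x) = pairing G r + pairing G r'.
Proof.
move=> bG ir ir'; rewrite /pairing -RintegralD//.
- by apply: eq_Rintegral => x _; rewrite mulrDr.
- exact: bounded_measurable_integrable.
- exact: bounded_measurable_integrable.
Qed.

Lemma pairingZr c G r : bounded_measurable G -> integrable r ->
  pairing G (fun x => c * r x) = c * pairing G r.
Proof.
move=> bG ir; rewrite /pairing -RintegralZl//.
- by apply: eq_Rintegral => x _; rewrite mulrCA.
- exact: bounded_measurable_integrable.
Qed.

Lemma pairingDl G G' r : bounded_measurable G -> bounded_measurable G' ->
  integrable r -> pairing (fun x => G x + G' x) r = pairing G r + pairing G' r.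
Proof.
move=> bG bG' ir; rewrite /pairing -RintegralD//.
- by apply: eq_Rintegral => x _; rewrite mulrDl.
- exact: bounded_measurable_integrable.
- exact: bounded_measurable_integrable.
Qed.

Lemma pairingZl c G r : bounded_measurable G -> integrable r ->
  pairing (fun x => c * G x) r = c * pairing G r.
Proof.
move=> bG ir; rewrite /pairing -RintegralZl//.
- by apply: eq_Rintegral => x _; rewrite mulrA.
- exact: bounded_measurable_integrable.
Qed.

Lemma pairingMr G r (phi : X -> R) :
  pairing G (fun x => phi x * r x) = pairing (fun x => G x * phi x) r.
Proof. by apply: eq_Rintegral => x _; rewrite mulrA. Qed.

Lemma pairing1 r : pairing (fun=> 1) r = \int[m]_x r x.
Proof. by apply: eq_Rintegral => x _; rewrite mul1r. Qed.

Lemma pairing_close G G' r c : bounded_measurable G -> bounded_measurable G' ->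
  integrable r -> (forall x, `|G x - G' x| <= c) ->
  `|pairing G r - pairing G' r| <= c * L1norm r.
Proof.
move=> bG bG' ir GG'.
have -> : pairing G r - pairing G' r = pairing (fun x => G x - G' x) r.
  rewrite /pairing -RintegralB//; [|exact: bounded_measurable_integrable..].
  by apply: eq_Rintegral => x _; rewrite mulrBl.
by apply: norm_pairing_le => //; apply: measurable_funB; [case: bG|case: bG'].
Qed.
End pairing.

Section limit_theorem.
Context d (X : measurableType d) (R : realType) (m : probability X R).
Variables (T : X -> X) (phi h : X -> R) (E : (X -> R) -> Prop) (M : R).
Hypothesis T_measurable : measurable_fun setT T.
Hypothesis phi_measurable : measurable_fun setT phi.
Hypothesis phi_le : forall x, `|phi x| <= M.
Hypothesis E_integrable : forall r, E r -> m.-integrable setT (EFin \o r).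
Hypothesis E_linear : forall a r r', E r -> E r' -> E (fun x => a * r x + r' x).
Hypothesis E_phi : forall r, E r -> E (fun x => phi x * r x).
Hypothesis E_h : E h.
Hypothesis h_prob : \int[m]_x h x = 1.
Hypothesis h_invariant : forall G, bounded_measurable G ->
  pairing m (G \o T) h = pairing m G h.
Hypothesis h_ge0 : forall G, bounded_measurable G -> (forall x, 0 <= G x) ->
  0 <= pairing m G h.
Hypothesis phi_centered : \int[m]_x (phi x * h x) = 0.
(* The Poisson equation [u - P u = P w], tested against bounded functions. *)
Hypothesis E_poisson : forall w, E w -> \int[m]_x w x = 0 ->
  exists2 u, E u & forall G, bounded_measurable G ->
    pairing m G u = pairing m (G \o T) (fun x => u x + w x).

Notation I := (pairing m).
Notation BS := (@birkhoff_sum X R T phi).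

Let bphi : bounded_measurable phi. Proof. by split => //; exists M. Qed.
Let M_ge0 : 0 <= M := le_trans (normr_ge0 _) (phi_le point).
Let bT (G : X -> R) : bounded_measurable G -> bounded_measurable (G \o T).
Proof. exact: bounded_measurable_comp. Qed.

Lemma bounded_measurable_birkhoff n : bounded_measurable (BS n).
Proof.
elim: n => [|n ih].
  rewrite (_ : BS 0%N = cst 0); first exact: bounded_measurable_cst.
  by apply/funext => x; rewrite /birkhoff_sum big_ord0.
rewrite (_ : BS n.+1 = (fun x => phi x + (BS n \o T) x)).
  exact: (bounded_measurableD bphi (bT ih)).
by apply/funext => x; rewrite birkhoff_sumS.
Qed.

(** Adding a multiple of [h] preserves the equation, since [h] is invariant. The multiple is chosen
    to kill the mean, so that a solution can be a right-hand side in turn, as [u1] is in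
    [variance_bound]. *)
Lemma E_poisson0 w : E w -> \int[m]_x w x = 0 ->
  exists u, [/\ E u, \int[m]_x u x = 0 & forall G, bounded_measurable G ->
    I G u = I (G \o T) (fun x => u x + w x)].
Proof.
move=> Ew w0; have [u Eu uw] := E_poisson Ew w0.
pose c := \int[m]_x u x.
have iZ k : m.-integrable setT (EFin \o (fun x => k * h x)).
  exact: (integrableZl measurableT k (E_integrable E_h)).
exists (fun x => - c * h x + u x); split.
- exact: E_linear.
- rewrite -pairing1 pairingDr//; do ?[exact: bounded_measurable_cst|exact: E_integrable].
  rewrite pairingZr//; do ?[exact: bounded_measurable_cst|exact: E_integrable].
  by rewrite !pairing1 h_prob mulr1 addNr.
- move=> G bG; have bGT := bT bG.
  rewrite [LHS]pairingDr//; last exact: E_integrable.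
  rewrite pairingZr//; last exact: E_integrable.
  rewrite -h_invariant// uw//.
  rewrite (_ : (fun x => - c * h x + u x + w x) = (fun x => - c * h x + (u x + w x))).
    rewrite [RHS]pairingDr//.
      by rewrite pairingZr//; exact: E_integrable.
    exact: (integrableD measurableT (E_integrable Eu) (E_integrable Ew)).
  by apply/funext => x; rewrite addrA.
Qed.

Section corrected_density.
Variables u1 u2 : X -> R.
Hypothesis E_u1 : E u1.
Hypothesis u1_mean0 : \int[m]_x u1 x = 0.
Hypothesis u1E : forall G, bounded_measurable G ->
  I G u1 = I (G \o T) (fun x => u1 x + phi x * h x).
(** The value that gives the right-hand side for [u2] mean zero. Formally [u1] is the sum of
    [P^k (phi h)] over k >= 1, and this becomes the Green-Kubo formula: the variance of [phi] plus
    twice the sum of its autocovariances. *)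
Let sigma2 := \int[m]_x (phi x ^+ 2 * h x + 2 * (phi x * u1 x)).
Hypothesis E_u2 : E u2.
Hypothesis u2E : forall G, bounded_measurable G ->
  I G u2 = I (G \o T) (fun x => u2 x +
    (2^-1 * (phi x ^+ 2 * h x) + phi x * u1 x - sigma2 / 2 * h x)).

Section trigonometric.
Variables (e a tau : R).
Hypothesis sigma2_ge0 : 0 <= sigma2.
Hypothesis e_le : `|e| <= tau.

Let C n x := cos (e * BS n x - a).
Let D n x := sin (e * BS n x - a).

Let bC n : bounded_measurable (C n).
Proof.
have [mS _] := bounded_measurable_birkhoff n.
split; last by exists 1 => x; exact: cos_max.
apply: (measurableT_comp (continuous_measurable_fun (@continuous_cos R))).
by apply: measurable_funB => //; exact: measurable_funM.
Qed.

Let bD n : bounded_measurable (D n).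
Proof.
have [mS _] := bounded_measurable_birkhoff n.
split; last by exists 1 => x; exact: sin_max.
apply: (measurableT_comp (continuous_measurable_fun (@continuous_sin R))).
by apply: measurable_funB => //; exact: measurable_funM.
Qed.

Let N := L1norm m.
(* The real part of [e^(-ia) \int e^(ieS_n) (h + ieu1 - e^2u2) dm]. *)
Let Z n := I (C n) h - e * I (D n) u1 - e ^+ 2 * I (C n) u2.

(** The first three terms are Taylor remainders; the last is what the eigenvalue correction
    [e^2 sigma2 / 2] does to the [u1] and [u2] parts of [Z]. Bounding [|e|] by [tau] makes the
    constant independent of [e], hence later of [n]. *)
Let K := M ^+ 3 * N h + M ^+ 2 * N u1 + M * N u2 +
  sigma2 / 2 * (N u1 + tau * N u2).

(** As [S_(n+1) = phi + S_n o T], expanding in [e phi] leaves integrals of [C n] and [D n] composed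
    with [T]. The equations for [h], [u1] and [u2] turn these back into integrals at time [n], and
    everything through order [e^2] matches the eigenvalue [1 - e^2 sigma2 / 2]. *)
Let corrected_step n :
  `|Z n.+1 - (1 - e ^+ 2 * sigma2 / 2) * Z n| <= `|e| ^+ 3 * K.
Proof.
have ih := E_integrable E_h; have i1 := E_integrable E_u1.
have i2 := E_integrable E_u2.
have arg x : e * BS n.+1 x - a = (e * BS n (T x) - a) + e * phi x.
  by rewrite birkhoff_sumS; ring.
have ephi x k : `|e * phi x| ^+ k <= `|e| ^+ k * M ^+ k.
  rewrite normrM exprMn ler_wpM2l ?exprn_ge0//.
  by rewrite lerXn2r ?nnegrE.
pose C' := C n \o T; pose D' := D n \o T.
have bC' : bounded_measurable C' by exact: bT.
have bD' : bounded_measurable D' by exact: bT.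
(* [C1] and [D1] are the Taylor polynomials of order 2 and 1. The [u2] part already carries [e^2],
   so order 0, that is [C'], suffices there. *)
pose C1 x := C' x + (- e * (D' x * phi x) + - (e ^+ 2 / 2) * (C' x * phi x * phi x)).
have bCp : bounded_measurable (fun x => C' x * phi x) by exact: bounded_measurableM.
have bDp : bounded_measurable (fun x => D' x * phi x) by exact: bounded_measurableM.
have bCpp : bounded_measurable (fun x => C' x * phi x * phi x).
  exact: bounded_measurableM.
have bC1a : bounded_measurable
    (fun x => - e * (D' x * phi x) + - (e ^+ 2 / 2) * (C' x * phi x * phi x)).
  by apply: bounded_measurableD; exact: bounded_measurableZ.
have bC1 : bounded_measurable C1 by exact: bounded_measurableD.
pose D1 x := D' x + e * (C' x * phi x).
have bD1 : bounded_measurable D1.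
  by apply: bounded_measurableD => //; exact: bounded_measurableZ.
have e0 : `|I (C n.+1) h - I C1 h| <= `|e| ^+ 3 * M ^+ 3 * N h.
  apply: pairing_close => // x; apply: le_trans (ephi x 3%N).
  rewrite /C arg (_ : C1 x = cos (e * BS n (T x) - a) - (e * phi x) * sin (e * BS n (T x) - a)
    - (e * phi x) ^+ 2 / 2 * cos (e * BS n (T x) - a)); first exact: cosD_taylor2.
  by rewrite /C1 /C' /D' /C /D /=; ring.
have e1 : `|I (D n.+1) u1 - I D1 u1| <= `|e| ^+ 2 * M ^+ 2 * N u1.
  apply: pairing_close => // x; apply: le_trans (ephi x 2%N).
  rewrite /D arg (_ : D1 x = sin (e * BS n (T x) - a) + (e * phi x) * cos (e * BS n (T x) - a)).
    by rewrite opprD addrA; exact: sinD_taylor1.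
  by rewrite /D1 /C' /D' /C /D /=; ring.
have e2 : `|I (C n.+1) u2 - I C' u2| <= `|e| * M * N u2.
  apply: pairing_close => // x; apply: le_trans (ephi x 1%N).
  by rewrite /C arg expr1; exact: cosD_taylor0.
have iph : m.-integrable setT (EFin \o (fun x => phi x * h x)).
  by apply: E_integrable; exact: E_phi.
have ipph : m.-integrable setT (EFin \o (fun x => phi x ^+ 2 * h x)).
  under eq_fun do rewrite expr2 -mulrA.
  by apply: E_integrable; do 2 apply: E_phi.
have ip1 : m.-integrable setT (EFin \o (fun x => phi x * u1 x)).
  by apply: E_integrable; exact: E_phi.
have Dn : I (D n) u1 = I D' u1 + I D' (fun x => phi x * h x).
  by rewrite u1E// pairingDr.
have E1 : I C1 h = I C' h - e * I D' (fun x => phi x * h x)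
    - e ^+ 2 / 2 * I C' (fun x => phi x ^+ 2 * h x).
  rewrite pairingDl// pairingDl//; [|exact: bounded_measurableZ..].
  rewrite !pairingZl// pairingMr.
  rewrite (_ : (fun x => phi x ^+ 2 * h x) = (fun x => phi x * (phi x * h x))).
    by rewrite !pairingMr; ring.
  by apply/funext => x; rewrite expr2 mulrA.
have E2 : I D1 u1 = I D' u1 + e * I C' (fun x => phi x * u1 x).
  rewrite pairingDl//; last exact: bounded_measurableZ.
  by rewrite pairingZl// pairingMr.
have Cn : I (C n) u2 = I C' u2 + 2^-1 * I C' (fun x => phi x ^+ 2 * h x) +
    I C' (fun x => phi x * u1 x) - sigma2 / 2 * I C' h.
  have Z1 (c : R) r : m.-integrable setT (EFin \o r) ->
    m.-integrable setT (EFin \o (fun x => c * r x)).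
    by move=> ir; exact: (integrableZl measurableT c ir).
  have Z2 r r' : m.-integrable setT (EFin \o r) -> m.-integrable setT (EFin \o r') ->
    m.-integrable setT (EFin \o (fun x => r x + r' x)).
    by move=> ir ir'; exact: (integrableD measurableT ir ir').
  have -> : I (C n) u2 = I C' (fun x => u2 x + (2^-1 * (phi x ^+ 2 * h x) +
      (phi x * u1 x + - (sigma2 / 2) * h x))).
    rewrite u2E//; apply: eq_Rintegral => x _; congr (_ * _).
    by rewrite -addrA mulNr.
  have A1 := Z1 2^-1 _ ipph; have A2 := Z1 (- (sigma2 / 2)) _ ih.
  have A3 := Z2 _ _ ip1 A2; have A4 := Z2 _ _ A1 A3.
  rewrite (pairingDr bC' i2 A4) (pairingDr bC' A1 A3) (pairingDr bC' ip1 A2).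
  by rewrite !pairingZr//; ring.
have Hn : I (C n) h = I C' h by rewrite h_invariant.
have b1 : `|I (D n) u1| <= N u1.
  by have [mD _] := bD n; rewrite -[leRHS]mul1r norm_pairing_le// => x; exact: sin_max.
have b2 : `|I (C n) u2| <= N u2.
  by have [mC _] := bC n; rewrite -[leRHS]mul1r norm_pairing_le// => x; exact: cos_max.
have -> : Z n.+1 - (1 - e ^+ 2 * sigma2 / 2) * Z n =
    (I (C n.+1) h - I C1 h) - e * (I (D n.+1) u1 - I D1 u1)
    - e ^+ 2 * (I (C n.+1) u2 - I C' u2)
    - e ^+ 2 * (sigma2 / 2) * (e * I (D n) u1 + e ^+ 2 * I (C n) u2).
  by rewrite /Z E1 E2 Hn Cn Dn; field.
have N1 := L1norm_ge0 m u1; have N2 := L1norm_ge0 m u2.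
have ge := normr_ge0 e.
rewrite (le_trans (ler_normB _ _))//.
rewrite (le_trans (lerD (ler_normB _ _) (lexx _)))//.
rewrite (le_trans (lerD (lerD (ler_normB _ _) (lexx _)) (lexx _)))//.
have s0 : 0 <= sigma2 / 2 by rewrite divr_ge0.
rewrite /K; move: (sigma2 / 2) s0 => s s0.
rewrite !(normrX, normrM) (ger0_norm s0).
have e3 : `|e * I (D n) u1 + e ^+ 2 * I (C n) u2| <= `|e| * (N u1 + tau * N u2).
  rewrite (le_trans (ler_normD _ _))// !(normrX, normrM) mulrDr lerD ?ler_wpM2l//.
  by rewrite expr2 -mulrA ler_wpM2l// ler_pM.
apply: (@le_trans _ _ (`|e| ^+ 3 * M ^+ 3 * N h + `|e| * (`|e| ^+ 2 * M ^+ 2 * N u1) +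
  `|e| ^+ 2 * (`|e| * M * N u2) + `|e| ^+ 2 * s * (`|e| * (N u1 + tau * N u2)))).
  by rewrite !lerD// ler_wpM2l// ?mulr_ge0 ?exprn_ge0.
by rewrite le_eqVlt; apply/orP; left; apply/eqP; ring.
Qed.

Let L := N u1 + tau * N u2.

Let Z_close n : `|Z n - I (C n) h| <= `|e| * L.
Proof.
have i1 := E_integrable E_u1; have i2 := E_integrable E_u2.
have b1 : `|I (D n) u1| <= N u1.
  by have [mD _] := bD n; rewrite -[leRHS]mul1r norm_pairing_le// => x; exact: sin_max.
have b2 : `|I (C n) u2| <= N u2.
  by have [mC _] := bC n; rewrite -[leRHS]mul1r norm_pairing_le// => x; exact: cos_max.
have -> : Z n - I (C n) h = - (e * I (D n) u1 + e ^+ 2 * I (C n) u2) by rewrite /Z; ring.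
rewrite normrN (le_trans (ler_normD _ _))// !(normrX, normrM) mulrDr lerD ?ler_wpM2l//.
by rewrite expr2 -mulrA ler_wpM2l// ler_pM.
Qed.

(** The factor [1 - x], with [x = e^2 sigma2 / 2], is replaced by [expR (- x)]: this lies in [0, 1]
    for every [e] and has the Gaussian as its exact n-th power. The price [x^2] is of order [e^4],
    turned into [tau |e|^3]. The term [2 |e| L] pays for exchanging [Z] with the plain integral at
    times [n] and 0. *)
Lemma char_bound n :
  `|I (C n) h - expR (- (e ^+ 2 * sigma2 / 2)) ^+ n * cos a| <=
  n%:R * (`|e| ^+ 3 * (K + tau * (sigma2 / 2) ^+ 2 * (N h + tau * L))) +
  2 * (`|e| * L).
Proof.
have s0 : 0 <= e ^+ 2 * sigma2 / 2 by rewrite divr_ge0 // mulr_ge0 // sqr_ge0.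
set q := expR _.
have q01 : 0 <= q <= 1 by rewrite expR_ge0 expR_le1 oppr_le0.
have N1 := L1norm_ge0 m u1; have N2 := L1norm_ge0 m u2.
have tau0 : 0 <= tau := le_trans (normr_ge0 e) e_le.
have L0 : 0 <= L by rewrite addr_ge0 ?mulr_ge0.
have Zb k : `|Z k| <= N h + tau * L.
  rewrite -[Z k](subrK (I (C k) h)) addrC (le_trans (ler_normD _ _))// lerD//.
    have [mC _] := bC k; rewrite -[leRHS]mul1r norm_pairing_le//.
      by move=> x; exact: cos_max.
    exact: E_integrable.
  by rewrite (le_trans (Z_close k))// ler_wpM2r.
have step k : `|Z k.+1 - q * Z k| <=
    `|e| ^+ 3 * (K + tau * (sigma2 / 2) ^+ 2 * (N h + tau * L)).
  have -> : Z k.+1 - q * Z k = (Z k.+1 - (1 - e ^+ 2 * sigma2 / 2) * Z k) +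
      ((1 - e ^+ 2 * sigma2 / 2) - q) * Z k by ring.
  rewrite [leRHS]mulrDr (le_trans (ler_normD _ _))// lerD ?corrected_step//.
  have -> : `|e| ^+ 3 * (tau * (sigma2 / 2) ^+ 2 * (N h + tau * L)) =
      `|e| ^+ 3 * tau * (sigma2 / 2) ^+ 2 * (N h + tau * L) by ring.
  rewrite normrM ler_pM// distrC (le_trans (expRN_taylor1 s0))//.
  have -> : (e ^+ 2 * sigma2 / 2) ^+ 2 = `|e| ^+ 3 * `|e| * (sigma2 / 2) ^+ 2.
    have e4 : `|e| ^+ 4 = e ^+ 4.
      by rewrite -normrX ger0_norm// (exprM e 2 2) sqr_ge0.
    by rewrite -exprSr e4; field.
  by rewrite ler_wpM2r ?sqr_ge0// ler_wpM2l// exprn_ge0.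
have Zn := norm_recurrence_le n q01 step.
have C0 : I (C 0) h = cos a.
  rewrite /pairing; transitivity (\int[m]_x (cos a * h x)).
    by apply: eq_Rintegral => x _; rewrite /C /birkhoff_sum big_ord0 mulr0 sub0r cosN.
  by rewrite RintegralZl ?h_prob ?mulr1//; exact: E_integrable.
have c0 := Z_close 0; rewrite C0 in c0.
have cn := Z_close n.
have qn : `|q ^+ n * Z 0%N - q ^+ n * cos a| <= `|e| * L.
  rewrite -mulrBr normrM (le_trans _ c0)// ler_piMl// normrX exprn_ile1//.
  by case/andP: q01 => q0 q1; rewrite ger0_norm.
move: Zn cn qn; rewrite !ler_norml; lra.
Qed.
End trigonometric.


Let boscillation n x : `|BS n (T x) - BS n x| <= 2 * M.
Proof.
rewrite birkhoff_sum_shift (le_trans (ler_normB _ _))//.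
by have := phi_le (iter n T x); have := phi_le x; lra.
Qed.

(** The identity [WE] is exact: by the equation for [u1], the cross term of [S_(n+1)^2] is
    compensated by [2 I (BS n) u1]. That correction stays bounded because [u1] has mean zero:
    solving the Poisson equation for it expresses [I (BS n) u1] through differences of [BS n] and
    [BS n o T]. *)
Lemma variance_bound : exists K, forall n,
  `|I (fun x => BS n x ^+ 2) h - n%:R * sigma2| <= K.
Proof.
have ih := E_integrable E_h; have i1 := E_integrable E_u1.
have iph : m.-integrable setT (EFin \o (fun x => phi x * h x)).
  by apply: E_integrable; exact: E_phi.
have ip1 : m.-integrable setT (EFin \o (fun x => phi x * u1 x)).
  by apply: E_integrable; exact: E_phi.
have ipph : m.-integrable setT (EFin \o (fun x => phi x ^+ 2 * h x)).
  under eq_fun do rewrite expr2 -mulrA.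
  by apply: E_integrable; do 2 apply: E_phi.
have bS n := bounded_measurable_birkhoff n.
have bS2 n : bounded_measurable (fun x => BS n x ^+ 2) by exact: bounded_measurableM.
have WE n : I (fun x => BS n x ^+ 2) h + 2 * I (BS n) u1 = n%:R * sigma2.
  elim: n => [|n ihn].
    rewrite mul0r /pairing; under eq_Rintegral do
      rewrite /birkhoff_sum big_ord0 expr0n/= mul0r.
    rewrite Rintegral_cst// mul0r add0r; under eq_Rintegral do
      rewrite /birkhoff_sum big_ord0 mul0r.
    by rewrite Rintegral_cst// mul0r mulr0.
  pose S' := BS n \o T; have bS' : bounded_measurable S' by exact: bT.
  have bSp : bounded_measurable (fun x => S' x * phi x) by exact: bounded_measurableM.
  have bpp : bounded_measurable (fun x => phi x * phi x) by exact: bounded_measurableM.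
  have bSS : bounded_measurable (fun x => S' x ^+ 2) by exact: bounded_measurableM.
  have -> : I (fun x => BS n.+1 x ^+ 2) h =
      I (fun x => S' x ^+ 2 + (2 * (S' x * phi x) + phi x * phi x)) h.
    by apply: eq_Rintegral => x _; rewrite birkhoff_sumS /S' /=; ring.
  rewrite pairingDl//; last by apply: bounded_measurableD => //; exact: bounded_measurableZ.
  rewrite pairingDl//; last exact: bounded_measurableZ.
  rewrite pairingZl//.
  have -> : I (BS n.+1) u1 = I (fun x => S' x + phi x) u1.
    by apply: eq_Rintegral => x _; rewrite birkhoff_sumS addrC.
  rewrite pairingDl//.
  have h2 : I (fun x => S' x ^+ 2) h = I (fun x => BS n x ^+ 2) h.
    exact: (h_invariant (bS2 n)).
  have h1 : I (BS n) u1 = I S' u1 + I (fun x => S' x * phi x) h.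
    by rewrite u1E// pairingDr// pairingMr.
  have hs : sigma2 = I (fun x => phi x * phi x) h + 2 * I phi u1.
    rewrite /sigma2 RintegralD//; last exact: (integrableZl measurableT 2 ip1).
    by rewrite RintegralZl.
  by rewrite h2 -[n.+1%:R]natr1 [in RHS]mulrDl mul1r -ihn h1 hs; ring.
have [w [Ew _ wE]] := E_poisson0 E_u1 u1_mean0.
have iw := E_integrable Ew.
exists (2 * (2 * M * L1norm m w + 2 * M * L1norm m u1)) => n.
have -> : I (fun x => BS n x ^+ 2) h - n%:R * sigma2 = - (2 * I (BS n) u1).
  by rewrite -WE; ring.
rewrite normrN normrM ger0_norm// ler_wpM2l//.
have bS' : bounded_measurable (BS n \o T) by exact: bT.
have -> : I (BS n) u1 = (I (BS n) w - I (BS n \o T) w) + (I (BS n) u1 - I (BS n \o T) u1).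
  by rewrite {1}(wE _ (bS n)) pairingDr//; ring.
rewrite (le_trans (ler_normD _ _))//.
by apply: lerD; apply: pairing_close => // x; rewrite distrC boscillation.
Qed.

(** The formula hides the sign; it is read off from second moments, which stay nonnegative while
    being within a constant of [n sigma2]. *)
Lemma sigma2_ge0 : 0 <= sigma2.
Proof.
have [K KP] := variance_bound.
rewrite leNgt; apply/negP => s0.
pose n := (Num.truncn (K / - sigma2)).+1.
have := KP n.
have p0 : 0 <= I (fun x => BS n x ^+ 2) h.
  apply: h_ge0 => [|x]; last exact: sqr_ge0.
  by apply: bounded_measurableM; exact: bounded_measurable_birkhoff.
have : K < n%:R * - sigma2.
  by rewrite -ltr_pdivrMr ?oppr_gt0// truncnS_gt.
rewrite mulrN ler_norml; lra.
Qed.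

Let normalize n x := BS n x / Num.sqrt n%:R.

Lemma cvg_variance : I (fun x => normalize n x ^+ 2) h @[n --> \oo] --> sigma2.
Proof.
have [K KP] := variance_bound.
have ih := E_integrable E_h.
apply: (@cvgn_sqrt_bound _ _ _ K) => n.
have n0 : 0 < n.+1%:R :> R by rewrite ltr0n.
have -> : I (fun x => normalize n.+1 x ^+ 2) h = n.+1%:R^-1 * I (fun x => BS n.+1 x ^+ 2) h.
  rewrite -pairingZl//; last first.
    by apply: bounded_measurableM; exact: bounded_measurable_birkhoff.
  apply: eq_Rintegral => x _; rewrite /normalize exprMn exprVn sqr_sqrtr ?ltW//.
  by rewrite [_ * n.+1%:R^-1]mulrC.
have -> : n.+1%:R^-1 * I (fun x => BS n.+1 x ^+ 2) h - sigma2 =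
    n.+1%:R^-1 * (I (fun x => BS n.+1 x ^+ 2) h - n.+1%:R * sigma2).
  by rewrite mulrBr mulKf ?gt_eqF.
rewrite normrM ger0_norm ?invr_ge0 ?(ltW n0)// mulrAC.
rewrite -[leRHS]mul1r ler_pM ?mulr_ge0 ?invr_ge0 ?sqrtr_ge0 ?(ltW n0)//.
rewrite mulrC ler_pdivrMr// mul1r -[leRHS]ger0_norm ?(ltW n0)// -sqrtr_sqr.
by rewrite ler_sqrt ?sqr_ge0// -natrX ler_nat leq_pmulr.
Qed.

(** Take [e = t / sqrt n] and [tau = |t|] in [char_bound]: since [n |e|^3 sqrt n = |t|^3], the error
    times [sqrt n] is bounded. *)
Lemma cvg_char t a : I (fun x => cos (t * normalize n x - a)) h @[n --> \oo] -->
  cos a * expR (- (sigma2 * t ^+ 2 / 2)).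
Proof.
pose L := L1norm m u1 + `|t| * L1norm m u2.
pose K := M ^+ 3 * L1norm m h + M ^+ 2 * L1norm m u1 + M * L1norm m u2 + sigma2 / 2 * L
  + `|t| * (sigma2 / 2) ^+ 2 * (L1norm m h + `|t| * L).
apply: (@cvgn_sqrt_bound _ _ _ (`|t| ^+ 3 * K + 2 * (`|t| * L))) => n.
have n0 : 0 < n.+1%:R :> R by rewrite ltr0n.
pose r : R := Num.sqrt n.+1%:R.
have r0 : 0 < r by rewrite sqrtr_gt0.
have r2 : r ^+ 2 = n.+1%:R by rewrite sqr_sqrtr ?ltW.
have r1 : 1 <= r by rewrite -[leLHS]sqrtr1 ler_sqrt// ler1n.
have et : `|t / r| <= `|t|.
  by rewrite normrM normfV (gtr0_norm r0) ler_piMr// invf_le1.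
have := char_bound a sigma2_ge0 et n.+1.
have -> : expR (- ((t / r) ^+ 2 * sigma2 / 2)) ^+ n.+1 = expR (- (sigma2 * t ^+ 2 / 2)).
  rewrite -expRM_natl; congr expR; rewrite -r2; field.
  by rewrite gt_eqF.
have -> : I (fun x => cos (t / r * BS n.+1 x - a)) h =
    I (fun x => cos (t * normalize n.+1 x - a)) h.
  by apply: eq_Rintegral => x _; rewrite /normalize -/r mulrAC -mulrA.
rewrite [_ * cos a]mulrC => /(ler_wpM2r (ltW r0)) /le_trans; apply.
rewrite normrM normfV (gtr0_norm r0) -/r -r2 -/L -/K le_eqVlt; apply/orP; left; apply/eqP.
by field; rewrite gt_eqF.
Qed.

(** For [w = f - h], the Poisson solution expresses [I (G n) w] through [G n - G n o T], which is of
    order 1 / sqrt n because [S_n o T - S_n] is bounded. *)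
Lemma cvg_char_density f t a : E f -> \int[m]_x f x = 1 ->
  I (fun x => cos (t * normalize n x - a)) f @[n --> \oo] -->
  cos a * expR (- (sigma2 * t ^+ 2 / 2)).
Proof.
move=> Ef f1; pose w x := - 1 * h x + f x.
have ih := E_integrable E_h; have iF := E_integrable Ef.
have Ew : E w by exact: E_linear.
have iw := E_integrable Ew.
have bc c := @bounded_measurable_cst _ X R c.
have i1h : m.-integrable setT (EFin \o (fun x => - 1 * h x)).
  exact: (integrableZl measurableT (- 1) ih).
have w0 : \int[m]_x w x = 0.
  by rewrite -pairing1 pairingDr// pairingZr// !pairing1 h_prob f1; ring.
have [u Eu uE] := E_poisson Ew w0; have iu := E_integrable Eu.
pose G n x := cos (t * normalize n x - a).
have bG n : bounded_measurable (G n).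
  have [mS _] := bounded_measurable_birkhoff n.
  split; last by exists 1 => x; exact: cos_max.
  apply: (measurableT_comp (continuous_measurable_fun (@continuous_cos R))).
  by apply: measurable_funB => //; do 2 apply: measurable_funM => //.
have GT n x : `|G n.+1 x - G n.+1 (T x)| * Num.sqrt n.+1%:R <= `|t| * (2 * M).
  have r0 : 0 < Num.sqrt n.+1%:R :> R by rewrite sqrtr_gt0.
  have -> : G n.+1 (T x) = cos (t * normalize n.+1 x - a +
      t * ((BS n.+1 (T x) - BS n.+1 x) / Num.sqrt n.+1%:R)).
    by congr cos; rewrite /normalize; field; rewrite gt_eqF.
  rewrite distrC (le_trans (ler_wpM2r (ltW r0) (cosD_taylor0 _ _)))//.
  by rewrite !normrM normfV (gtr0_norm r0) mulrA divfK ?gt_eqF// ler_wpM2l.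
have c0 : I (G n) w @[n --> \oo] --> (0 : R).
  pose B := `|t| * (2 * M) * L1norm m u + `|t| * (2 * M) * L1norm m w.
  apply: (@cvgn_sqrt_bound _ _ _ B) => n; rewrite subr0.
  have r0 : 0 < Num.sqrt n.+1%:R :> R by rewrite sqrtr_gt0.
  have bGT : bounded_measurable (G n.+1 \o T) by exact: bT.
  have -> : I (G n.+1) w = (I (G n.+1) u - I (G n.+1 \o T) u) +
      (I (G n.+1) w - I (G n.+1 \o T) w).
    by rewrite {1}uE// pairingDr//; ring.
  have GT' x : `|G n.+1 x - (G n.+1 \o T) x| <= `|t| * (2 * M) / Num.sqrt n.+1%:R.
    by rewrite ler_pdivlMr// GT.
  have pu := pairing_close (bG n.+1) bGT iu GT'.
  have pw := pairing_close (bG n.+1) bGT iw GT'.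
  rewrite -ler_pdivlMr// (le_trans (ler_normD _ _))// (le_trans (lerD pu pw))//.
  rewrite le_eqVlt; apply/orP; left; apply/eqP; rewrite /B.
  by field; rewrite gt_eqF.
have ch := @cvg_char t a.
have : I (G n) w + I (G n) h @[n --> \oo] --> 0 + cos a * expR (- (sigma2 * t ^+ 2 / 2)).
  exact: cvgD.
rewrite add0r; apply: cvg_trans; apply: near_eq_cvg; apply: nearW => n.
by rewrite pairingDr// pairingZr//; ring.
Qed.
End corrected_density.

Theorem poisson_clt : exists2 v : R, 0 <= v &
  I (fun x => (BS n x / Num.sqrt n%:R) ^+ 2) h @[n --> \oo] --> v /\
  forall f t a, E f -> \int[m]_x f x = 1 ->
    I (fun x => cos (t * (BS n x / Num.sqrt n%:R) - a)) f @[n --> \oo] -->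
    cos a * expR (- (v * t ^+ 2 / 2)).
Proof.
have Eph : E (fun x => phi x * h x) by exact: E_phi.
have ih := E_integrable E_h; have iph := E_integrable Eph.
have [u1 [Eu1 u10 u1E]] := E_poisson0 Eph phi_centered.
have Ep1 : E (fun x => phi x * u1 x) by exact: E_phi.
have Epph : E (fun x => phi x ^+ 2 * h x).
  rewrite (_ : (fun x => _) = (fun x => phi x * (phi x * h x))); first exact: E_phi.
  by apply/funext => x; rewrite expr2 mulrA.
have ip1 := E_integrable Ep1; have ipph := E_integrable Epph.
pose v := \int[m]_x (phi x ^+ 2 * h x + 2 * (phi x * u1 x)).
pose w x := 2^-1 * (phi x ^+ 2 * h x) + phi x * u1 x - v / 2 * h x.
have Ew : E w.
  rewrite (_ : w = (fun x => - (v / 2) * h x +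
      (2^-1 * (phi x ^+ 2 * h x) + phi x * u1 x))).
    by do 2 apply: E_linear => //.
  by apply/funext => x; rewrite /w; ring.
have Z1 (c : R) r : m.-integrable setT (EFin \o r) ->
    m.-integrable setT (EFin \o (fun x => c * r x)).
  by move=> ir; exact: (integrableZl measurableT c ir).
have w0 : \int[m]_x w x = 0.
  rewrite RintegralB//; last 2 first.
  - exact: (integrableD measurableT (Z1 2^-1 _ ipph) ip1).
  - exact: Z1.
  rewrite RintegralD ?RintegralZl ?h_prob//; last exact: Z1.
  rewrite /v RintegralD ?RintegralZl//; last exact: Z1.
  by field.
have [u2 Eu2 u2E] := E_poisson Ew w0.
exists v; first exact: (sigma2_ge0 Eu1 u10 u1E).
split; first exact: (cvg_variance Eu1 u10 u1E).
move=> f t a Ef f1; exact: (cvg_char_density Eu1 u10 u1E Eu2 u2E Ef f1).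
Qed.
End limit_theorem.

(** * The Poisson equation in B *)

Section spectral_poisson.
Context (R : realType) (V : normedModType R[i]).

(** A nonzero [Pi i v] is an eigenvector for [lambda i], so only [lambda i = 1] matters and
    [P = Pr + Q], where [Pr] projects onto the fixed vectors, a line containing [h]. The functional
    [l], in practice the mean, detects that line, so [l v = 0] forces [Pr v = 0]. The inverse of
    [1 - Q] keeps [v] in the kernel of [Pr], where [P] and [Q] agree. *)
Lemma spectral_poisson (P : {linear V -> V}) (h : V) (l : V -> R[i]) :
  quasi_compact_diagonal P -> simple_eigenvalue P 1 ->
  (forall z, is_eigenvalue P z -> `|z| = 1 -> z = 1) ->
  P h = h -> (forall u v, l (u - v) = l u - l v) -> (forall v, l (P v) = l v) ->
  (forall c, l (c *: h) = c) ->
  forall v, l v = 0 -> exists u, u - P u = v.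
Proof.
move=> [s [lambda [Pi [Q [PE lambda1 Piproj Piorth [_ Qrad PiQ]]]]]].
move=> [v0 [v0n0 Pv0] v0ker] P_no_other Ph lB lP lh.
have lamE i v : lambda i *: Pi i v = Pi i v.
  have [->|n0] := eqVneq (Pi i v) 0; first by rewrite scaler0.
  rewrite [lambda i]P_no_other ?scale1r//.
  exists (Pi i v) => //; rewrite PE (PiQ i v).1 addr0 (bigD1 i)//= big1 ?addr0.
    by rewrite (Piproj i).2.
  by move=> j ji; rewrite Piorth ?scaler0.
pose Pr v := \sum_(i < s) Pi i v.
have {}PE v : P v = Pr v + Q v.
  by rewrite PE; congr (_ + _); apply: eq_bigr => i _; rewrite lamE.
have PrD u v : Pr (u + v) = Pr u + Pr v.
  by rewrite /Pr -big_split; apply: eq_bigr => i _; rewrite linearD.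
have PrQ v : Pr (Q v) = 0 by apply: big1 => i _; rewrite (PiQ i v).2.
have QPr v : Q (Pr v) = 0.
  by rewrite linear_sum; apply: big1 => i _; rewrite (PiQ i v).1.
have PrPr v : Pr (Pr v) = Pr v.
  apply: eq_bigr => i _; rewrite linear_sum (bigD1 i)//= big1 ?addr0.
    by rewrite (Piproj i).2.
  by move=> j ji; rewrite Piorth// eq_sym.
(* If 1 were in the spectrum of [Q], the spectral radius would be at least 1. *)
have [S [_ S1 S2]] : exists S : {linear V -> V}, [/\ bounded_operator S,
    (forall v, S (1 *: v - Q v) = v) & (forall v, 1 *: S v - Q (S v) = v)].
  apply: contrapT => Q1; move: Qrad; apply/negP; rewrite -leNgt.
  apply: ereal_sup_ubound; exists 1 => //.
  by rewrite /rnorm normr1.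
(* On the range of [Q], [P] acts as [Q], so [l (Q (Q u)) = l (Q u)]; writing [v = u - Q u] with
   [u = S v] concludes. *)
have lQ v : l (Q v) = 0.
  rewrite -[v]S2 scale1r linearB lB -[l (Q (S v))]lP PE PrQ add0r.
  by rewrite subrr.
have line w : P w = w -> exists c, w = c *: v0.
  by move=> Pw; apply: (v0ker 1%N); rewrite /= Pw scale1r subrr.
have [c0 hE] := line h Ph.
have c0n0 : c0 != 0.
  apply/eqP => c00; have := lh 1; rewrite hE c00 scale0r scaler0.
  have -> : l 0 = 0 by rewrite -[X in l X](subrr 0) lB subrr.
  by move/esym/eqP; rewrite oner_eq0.
move=> v lv; have [c1 PrE] : exists c, Pr v = c *: v0.
  by apply: line; rewrite PE PrPr QPr addr0.
have Prv : Pr v = 0.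
  have PrE' : Pr v = (c1 / c0) *: h by rewrite hE scalerA divfK.
  have : l (Pr v) = 0.
    by rewrite -[Pr v](addrK (Q v)) -PE lB lP lQ lv subrr.
  by rewrite PrE' lh => ->; rewrite scale0r.
exists (S v); have Sv := S2 v; rewrite scale1r in Sv.
have PrS : Pr (S v) = 0.
  by rewrite -[S v](subrK (Q (S v))) Sv PrD Prv PrQ addr0.
by rewrite PE PrS add0r.
Qed.
End spectral_poisson.

(** * Duality between composition with T and image charges *)

Section duality.
Import HBNNSimple.
Context d (X : measurableType d) (R : realType) (m : probability X R).

Lemma pairing_ae_eq (G r r' : X -> R) : bounded_measurable G ->
  m.-integrable setT (EFin \o r) -> measurable_fun setT r' ->
  {ae m, forall x, r x = r' x} -> pairing m G r = pairing m G r'.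
Proof.
move=> [mG _] ir mr' rr'.
have mr : measurable_fun setT r by move: ir => /measurable_int/measurable_EFinP.
congr fine; apply: ae_eq_integral => //.
- by apply/measurable_EFinP; exact: measurable_funM.
- by apply/measurable_EFinP; exact: measurable_funM.
- by apply: filterS rr' => x + _ => /= ->.
Qed.

Lemma pairing_sum_indic (s : seq R) (A : R -> set X) (r : X -> R) :
  m.-integrable setT (EFin \o r) -> (forall y, measurable (A y)) ->
  pairing m (fun x => \sum_(y <- s) y * \1_(A y) x) r =
  \sum_(y <- s) y * \int[m]_(x in A y) r x.
Proof.
move=> ir mA.
have bA y : bounded_measurable (\1_(A y) : X -> R).
  split; first exact: measurable_indic.
  by exists 1 => x; rewrite indicE; case: (_ \in _); rewrite /= ?normr1 ?normr0.
suff [_ ->] : bounded_measurable (fun x => \sum_(y <- s) y * \1_(A y) x : R) /\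
  pairing m (fun x => \sum_(y <- s) y * \1_(A y) x) r =
  \sum_(y <- s) y * \int[m]_(x in A y) r x by [].
elim: s => [|y s [bs ih]].
  split; first by under eq_fun do rewrite big_nil; exact: bounded_measurable_cst.
  rewrite /pairing; under eq_Rintegral do rewrite big_nil mul0r.
  by rewrite Rintegral_cst// mul0r big_nil.
split.
  under eq_fun do rewrite big_cons.
  by apply: bounded_measurableD => //; exact: bounded_measurableZ.
rewrite big_cons -ih; under [X in pairing m X]eq_fun do rewrite big_cons.
rewrite pairingDl//; last exact: bounded_measurableZ.
rewrite pairingZl//; congr (_ * _ + _).
rewrite [RHS]Rintegral_mkcond; apply: eq_Rintegral => x _.
by rewrite patch_indic mulrC.
Qed.

(** Equality on sets passes to simple functions and then to bounded ones by dominated convergence.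
    Monotone approximation wants nonnegative functions, hence the shift by [M], which cancels
    because [f] and [r] have the same total integral. It applies to the transfer operator and also,
    with [f = r], to an invariant density. *)
Lemma pairing_comp_of_charge (T : X -> X) (f r G : X -> R) :
  measurable_fun setT T ->
  m.-integrable setT (EFin \o f) -> m.-integrable setT (EFin \o r) ->
  (forall A, measurable A ->
    \int[m]_(x in A) r x = \int[m]_(x in T @^-1` A) f x) ->
  bounded_measurable G -> pairing m (G \o T) f = pairing m G r.
Proof.
move=> mT iF ir fr [mG [M GM]].
have mTA A : measurable A -> measurable (T @^-1` A).
  by move=> mA; rewrite -[X in measurable X]setTI; exact: mT.
pose H x := (G x + M)%:E.
have mH : measurable_fun setT H.
  by apply/measurable_EFinP; exact: measurable_funD.
have H0 x : (0 <= H x)%E.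
  by rewrite lee_fin; have := GM x; rewrite ler_norml; lra.
pose g := nnsfun_approx measurableT mH.
have gH x : g n x @[n --> \oo] --> G x + M.
  have := @cvg_nnsfun_approx _ _ _ setT measurableT H mH (fun x _ => H0 x) x I.
  by move=> /fine_cvgP[].
have gM n x : `|g n x| <= 2 * M.
  have nd : nondecreasing_seq (fun n => g n x).
    by move=> k k' kk'; have /lefP := nd_nnsfun_approx measurableT mH kk'; exact.
  rewrite ger0_norm//; apply: le_trans (nondecreasing_cvgn_le nd _ n) _.
    by apply/cvg_ex; exists (G x + M); exact: gH.
  rewrite (cvg_lim _ (gH x))//.
  by have := GM x; rewrite ler_norml; lra.
have sE n : pairing m (g n \o T) f = pairing m (g n) r.
  pose s : seq R := finmap.enum_fset (fset_set (range (g n))).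
  have gE x : g n x = \sum_(y <- s) y * \1_(g n @^-1` [set y]) x.
    by rewrite fimfunE fsbig_finite//.
  have mg y : measurable (g n @^-1` [set y]) by exact: measurable_funPTI.
  have Er : pairing m (g n) r = \sum_(y <- s) y * \int[m]_(x in g n @^-1` [set y]) r x.
    rewrite -pairing_sum_indic//.
    by apply: eq_Rintegral => x _; rewrite gE.
  have Ef : pairing m (g n \o T) f =
      \sum_(y <- s) y * \int[m]_(x in T @^-1` (g n @^-1` [set y])) f x.
    rewrite -(pairing_sum_indic _ iF (fun y => mTA _ (mg y))).
    by apply: eq_Rintegral => x _; rewrite /= gE.
  by rewrite Er Ef; apply: eq_bigr => y _; rewrite fr.
have lim (F : X -> R) (t : X -> X) : measurable_fun setT t -> m.-integrable setT (EFin \o F) ->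
    pairing m (g n \o t) F @[n --> \oo] --> pairing m ((fun x => G x + M) \o t) F.
  move=> mt iF'; apply: (@dominated_cvg_Rintegral _ _ _ _ _ _ (fun x => 2 * M * `|F x|)).
  - move=> n; apply: measurable_funM; first exact: measurableT_comp.
    by move: iF' => /measurable_int/measurable_EFinP.
  - by move=> x; apply: cvgM; [exact: gH|exact: cvg_cst].
  - by move=> n x; rewrite normrM ler_wpM2r//; exact: gM.
  - exact: (integrableZl measurableT (2 * M) (integrable_norm iF')).
have l1 := lim f T mT iF; have l2 := lim r idfun (@measurable_id _ _ _) ir.
have bG : bounded_measurable G by split=> //; exists M.
have bGT : bounded_measurable (G \o T) by exact: bounded_measurable_comp.
have bM : bounded_measurable (fun _ : X => M) by exact: bounded_measurable_cst.
have eq : pairing m ((fun x => G x + M) \o T) f = pairing m (fun x => G x + M) r.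
  have sE' : (fun n => pairing m (g n \o T) f) = (fun n => pairing m (g n \o idfun) r).
    by apply/funext => n; exact: sE.
  by rewrite sE' in l1; exact: (cvg_unique _ l1 l2).
have frT : \int[m]_x f x = \int[m]_x r x by rewrite fr// preimage_setT.
move: eq; rewrite /comp /= (pairingDl bGT bM iF) (pairingDl bG bM ir).
have cM F : m.-integrable setT (EFin \o F) -> pairing m (fun=> M) F = M * \int[m]_x F x.
  by move=> iF'; rewrite -RintegralZl.
by rewrite !cM// frT => /addIr.
Qed.
End duality.

Local Open Scope complex_scope.

(** * Densities of absolutely continuous probabilities *)

Section density_function.
Context d (X : measurableType d) (R : realType) (m nu : probability X R).
Hypothesis nu_ac : nu `<< m.

Lemma density_integral A : measurable A ->
  nu A = (\int[m]_(x in A) (density m nu x)%:E)%E.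
Proof.
move=> mA.
transitivity (\int[m]_(x in A) Radon_Nikodym (charge_of_finite_measure nu) m x)%E.
  by rewrite -Radon_Nikodym_integral.
by apply: eq_integral => x _; rewrite fineK// Radon_Nikodym_fin_num.
Qed.

Lemma density_integrable : m.-integrable setT (EFin \o density m nu).
Proof.
have := @Radon_Nikodym_integrable _ _ _ (charge_of_finite_measure nu) m nu_ac.
apply: eq_integrable => // x _.
by rewrite /= fineK// Radon_Nikodym_fin_num.
Qed.

Lemma pairing_density G : bounded_measurable G ->
  pairing m G (density m nu) = \int[nu]_x G x.
Proof.
move=> [mG [M GM]]; apply/esym.
exact: Rintegral_density nu_ac density_integrable density_integral mG GM.
Qed.

Lemma density_prob : \int[m]_x density m nu x = 1.
Proof. by rewrite /Rintegral -density_integral// probability_setT. Qed.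
End density_function.

(** * The transfer operator tested against bounded functions *)

Section transfer_duality.
Context d (X : measurableType d) (R : realType) (m : probability X R).
Variable T : {mfun X >-> X}.
Hypothesis T_nonsingular : pushforward m T `<< m.

Lemma measurable_preimage_T A : measurable A -> measurable (T @^-1` A).
Proof. by move=> mA; exact: measurable_funPTI. Qed.

(** Non-singularity of [T] enters here: it makes the derivative taken in [transfer] a genuine
    density of the image charge. *)
Lemma image_charge_dominates (f : X -> \bar R) (intf : m.-integrable setT f) :
  image_charge T intf `<< m.
Proof.
apply/null_content_dominatesP => A mA mA0.
have mTA := measurable_preimage_T mA.
have TA0 : m (T @^-1` A) = 0%E.
  by move/null_content_dominatesP : T_nonsingular; apply.
apply: null_set_integral => //.
by apply: measurable_funTS; exact: measurable_int intf.
Qed.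

Lemma pairing_image_charge (f : X -> R) (intf : m.-integrable setT (EFin \o f)) G :
  bounded_measurable G ->
  pairing m (G \o T) f =
  pairing m G (fun x => fine (Radon_Nikodym (image_charge T intf) m x)).
Proof.
move=> bG; have dom := image_charge_dominates intf.
have RNE x : (fine (Radon_Nikodym (image_charge T intf) m x))%:E =
    Radon_Nikodym (image_charge T intf) m x.
  by rewrite fineK// Radon_Nikodym_fin_num.
apply: pairing_comp_of_charge => //.
  apply: eq_integrable (Radon_Nikodym_integrable dom) => // x _.
  by rewrite /= RNE.
move=> A mA; congr fine.
under eq_integral do rewrite RNE.
by rewrite -Radon_Nikodym_integral.
Qed.
End transfer_duality.

(** * Real and imaginary parts of elements of B *)

Section banach_space.
Context d (X : measurableType d) (R : realType) (m : probability X R).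
Variable B : L1_banach_space m.
Implicit Types u v : B.

Definition re u x := complex.Re (repr_fun u x).
Definition im u x := complex.Im (repr_fun u x).

Lemma re_integrable u : m.-integrable setT (EFin \o re u).
Proof. exact: (repr_fun_integrable u).1. Qed.

Lemma im_integrable u : m.-integrable setT (EFin \o im u).
Proof. exact: (repr_fun_integrable u).2. Qed.

Lemma repr_fun0 : {ae m, forall x, repr_fun (0 : B) x = 0}.
Proof.
apply: filterS (repr_fun_linear (-1) 0 (0 : B)) => x.
by rewrite scaler0 addr0 mulN1r addNr.
Qed.

Lemma repr_funZ a u : {ae m, forall x, repr_fun (a *: u) x = a * repr_fun u x}.
Proof.
apply: filterS2 (repr_fun_linear a u 0) repr_fun0 => x.
by rewrite addr0 => -> ->; rewrite addr0.
Qed.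

Lemma repr_funD u v :
  {ae m, forall x, repr_fun (u + v) x = repr_fun u x + repr_fun v x}.
Proof.
apply: filterS (repr_fun_linear 1 u v) => x.
by rewrite scale1r mul1r.
Qed.

(** The integral against [m], which serves as the functional [l] of [spectral_poisson]. *)
Definition cmean u : R[i] := (\int[m]_x re u x) +i* (\int[m]_x im u x).

Lemma re_measurable u : measurable_fun setT (re u).
Proof. by have := re_integrable u => /measurable_int/measurable_EFinP. Qed.

Lemma Rintegral_ae_eq (f g : X -> R) : m.-integrable setT (EFin \o f) ->
  m.-integrable setT (EFin \o g) -> {ae m, forall x, f x = g x} ->
  \int[m]_x f x = \int[m]_x g x.
Proof.
move=> iF iG fg; rewrite -!pairing1; apply: pairing_ae_eq => //.
  exact: bounded_measurable_cst.
by move: iG => /measurable_int/measurable_EFinP.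
Qed.

Lemma cmeanB u v : cmean (u - v) = cmean u - cmean v.
Proof.
have reB : {ae m, forall x, re (u - v) x = re u x - re v x}.
  have := repr_fun_linear (-1) v u; apply: filterS => x.
  rewrite scaleN1r addrC /re => ->; rewrite mulN1r.
  by case: (repr_fun u x) (repr_fun v x) => a b [a' b'] /=; rewrite addrC.
have imB : {ae m, forall x, im (u - v) x = im u x - im v x}.
  have := repr_fun_linear (-1) v u; apply: filterS => x.
  rewrite scaleN1r addrC /im => ->; rewrite mulN1r.
  by case: (repr_fun u x) (repr_fun v x) => a b [a' b'] /=; rewrite addrC.
rewrite /cmean (Rintegral_ae_eq (re_integrable _) _ reB); last first.
  exact: (integrableB measurableT (re_integrable u) (re_integrable v)).
rewrite (Rintegral_ae_eq (im_integrable _) _ imB); last first.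
  exact: (integrableB measurableT (im_integrable u) (im_integrable v)).
rewrite !RintegralB//; do ?[exact: re_integrable|exact: im_integrable].
Qed.

Lemma cmeanZ_real c u (r : X -> R) : m.-integrable setT (EFin \o r) ->
  \int[m]_x r x = 1 -> {ae m, forall x, repr_fun u x = (r x)%:C} ->
  cmean (c *: u) = c.
Proof.
move=> ir r1 ur; case: c => a b.
have reZ : {ae m, forall x, re ((a +i* b) *: u) x = a * r x}.
  apply: filterS2 ur (repr_funZ (a +i* b) u) => x ux.
  by rewrite /re => ->; rewrite ux /= mulr0 subr0.
have imZ : {ae m, forall x, im ((a +i* b) *: u) x = b * r x}.
  apply: filterS2 ur (repr_funZ (a +i* b) u) => x ux.
  by rewrite /im => ->; rewrite ux /= mulr0 add0r.
rewrite /cmean (Rintegral_ae_eq (re_integrable _) _ reZ); last first.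
  exact: (integrableZl measurableT a ir).
rewrite (Rintegral_ae_eq (im_integrable _) _ imZ); last first.
  exact: (integrableZl measurableT b ir).
by rewrite !RintegralZl// r1 !mulr1.
Qed.

(** The class [E] of the limit theorem: actual functions representing elements of B, so that
    products and combinations are taken pointwise. *)
Definition in_real_space (r : X -> R) : Prop :=
  m.-integrable setT (EFin \o r) /\ in_space B (fun x => (r x)%:C).

Lemma in_real_space_linear a r r' : in_real_space r -> in_real_space r' ->
  in_real_space (fun x => a * r x + r' x).
Proof.
move=> [ir [u ur]] [ir' [v vr]]; split.
  exact: (integrableD measurableT (integrableZl measurableT a ir) ir').
exists (a%:C *: u + v); apply: filterS3 ur vr (repr_fun_linear a%:C u v) => x -> -> ->.
by rewrite rmorphD rmorphM.
Qed.

(** Half the sum with the conjugate; this extracts a real solution from a complex one. *)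
Lemma in_real_space_re u :
  (forall f : B, in_space B (fun x => (repr_fun f x)^*%C)) ->
  in_real_space (re u).
Proof.
move=> conjB; split; first exact: re_integrable.
have [v vu] := conjB u; exists (2^-1 *: (u + v)).
apply: filterS3 vu (repr_funD u v) (repr_funZ 2^-1 (u + v)) => x vx uv ->.
by rewrite uv vx addcJ mulKf// /re.
Qed.

Lemma in_real_spaceM (phi r : X -> R) (M C : R) : measurable_fun setT phi ->
  (forall x, `|phi x| <= M) -> in_space B (fun x => (phi x)%:C) ->
  (forall f g : B, exists2 h : B,
     {ae m, forall x, repr_fun h x = repr_fun f x * repr_fun g x} &
     rnorm h <= C * rnorm f * rnorm g) ->
  in_real_space r -> in_real_space (fun x => phi x * r x).
Proof.
move=> mphi phiM [p pE] alg [ir [u ur]]; split.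
  exact: integrable_boundedM mphi phiM ir.
have [w wE _] := alg p u; exists w.
by apply: filterS3 pE ur wE => x px ux ->; rewrite px ux rmorphM.
Qed.
End banach_space.

(** * The Poisson equation for real functions with class in B *)

Section real_poisson.
Context (R : realType) d (X : measurableType d) (m : probability X R).
Variables (T : {mfun X >-> X}) (B : L1_banach_space m) (P : {linear B -> B}).
Hypothesis T_nonsingular : pushforward m T `<< m.
Hypothesis P_transfer : forall f : B, {ae m, forall x,
  repr_fun (P f) x = transfer T (repr_fun_integrable f) x}.

Lemma pairing_re_transfer (u : B) G : bounded_measurable G ->
  pairing m (G \o T) (re u) = pairing m G (re (P u)).
Proof.
move=> bG.
rewrite (@pairing_image_charge _ _ _ m T T_nonsingular _ (repr_fun_integrable u).1)//.
apply/esym; apply: pairing_ae_eq => //; first exact: re_integrable.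
- have /measurable_int mRN := Radon_Nikodym_integrable
    (image_charge_dominates T_nonsingular (repr_fun_integrable u).1).
  exact: measurableT_comp mRN.
- by apply: filterS (P_transfer u) => x; rewrite /re => ->.
Qed.

Lemma pairing_im_transfer (u : B) G : bounded_measurable G ->
  pairing m (G \o T) (im u) = pairing m G (im (P u)).
Proof.
move=> bG.
rewrite (@pairing_image_charge _ _ _ m T T_nonsingular _ (repr_fun_integrable u).2)//.
apply/esym; apply: pairing_ae_eq => //; first exact: im_integrable.
- have /measurable_int mRN := Radon_Nikodym_integrable
    (image_charge_dominates T_nonsingular (repr_fun_integrable u).2).
  exact: measurableT_comp mRN.
- by apply: filterS (P_transfer u) => x; rewrite /im => ->.
Qed.

Lemma cmean_transfer (u : B) : cmean (P u) = cmean u.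
Proof.
have b1 := @bounded_measurable_cst _ X R 1.
rewrite /cmean -!pairing1.
by rewrite -(pairing_re_transfer u b1) -(pairing_im_transfer u b1).
Qed.

(** Invariance says that the image charge of the real part is [mu] again, while the imaginary part
    has zero charge; uniqueness of densities and injectivity of [repr_fun] conclude. *)
Lemma transfer_fixes_density (mu : probability X R) (h : B) : mu `<< m ->
  (forall A, measurable A -> mu (T @^-1` A) = mu A) ->
  {ae m, forall x, repr_fun h x = (density m mu x)%:C} -> P h = h.
Proof.
move=> mu_ac mu_inv hE; apply/eqP; rewrite -subr_eq0; apply/eqP/repr_fun_inj.
have RN (f r : X -> R) (intf : m.-integrable setT (EFin \o f)) :
    m.-integrable setT (EFin \o r) ->
    (forall A, measurable A ->
      (\int[m]_(x in T @^-1` A) (f x)%:E = \int[m]_(x in A) (r x)%:E)%E) ->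
    {ae m, forall x, fine (Radon_Nikodym (image_charge T intf) m x) = r x}.
  move=> ir fr; have dom := image_charge_dominates T_nonsingular intf.
  have : ae_eq m setT (Radon_Nikodym (image_charge T intf) m) (EFin \o r).
    apply: integral_ae_eq => //.
    - exact: Radon_Nikodym_integrable.
    - exact: measurable_int ir.
    - by move=> A _ mA; rewrite -Radon_Nikodym_integral// -fr.
  by apply: filterS => x /(_ I) ->.
have mT A : measurable A -> measurable (T @^-1` A).
  by move=> mA; exact: measurable_funPTI.
have reRN := RN (re h) (density m mu) (repr_fun_integrable h).1.
have imRN := RN (im h) (fun=> 0) (repr_fun_integrable h).2.
have aere : {ae m, forall x, fine (Radon_Nikodym
    (image_charge T (repr_fun_integrable h).1) m x) = density m mu x}.
  apply: reRN; first exact: density_integrable.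
  move=> A mA; rewrite -density_integral// -mu_inv// (density_integral mu_ac (mT _ mA)).
  apply: ae_eq_integral; first exact: mT.
  - by apply: measurable_funTS; exact: measurable_int (re_integrable h).
  - by apply: measurable_funTS; exact: measurable_int (density_integrable mu_ac).
  - by apply: filterS hE => x + _; rewrite /re => ->.
have aeim : {ae m, forall x, fine (Radon_Nikodym
    (image_charge T (repr_fun_integrable h).2) m x) = 0}.
  apply: imRN; first exact: integrable0.
  move=> A mA; rewrite integral0.
  rewrite -[RHS](integral0 m (T @^-1` A)).
  apply: ae_eq_integral; first exact: mT.
  - by apply: measurable_funTS; exact: measurable_int (im_integrable h).
  - exact: measurable_cst.
  - by apply: filterS hE => x + _; rewrite /im => ->.
have aeT : {ae m, forall x,
    transfer T (repr_fun_integrable h) x = (density m mu x)%:C}.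
  by apply: filterS2 aere aeim => x rx ix; rewrite /transfer rx ix.
have sub := repr_fun_linear (-1) h (P h).
have aeP : {ae m, forall x, repr_fun (P h) x = repr_fun h x}.
  by apply: filterS3 (P_transfer h) aeT hE => x -> -> ->.
apply: filterS2 sub aeP => x; rewrite scaleN1r addrC => -> ->.
by rewrite mulN1r addNr.
Qed.

Lemma real_poisson (mu : probability X R) :
  (forall f : B, in_space B (fun x => (repr_fun f x)^*%C)) ->
  quasi_compact_diagonal P -> simple_eigenvalue P 1 ->
  (forall z : R[i], is_eigenvalue P z -> `|z| = 1 -> z = 1) ->
  mu `<< m -> (forall A, measurable A -> mu (T @^-1` A) = mu A) ->
  in_space B (fun x => (density m mu x)%:C) ->
  forall w, in_real_space B w -> \int[m]_x w x = 0 ->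
  exists2 u, in_real_space B u & forall G, bounded_measurable G ->
    pairing m G u = pairing m (G \o T) (fun x => u x + w x).
Proof.
move=> conjB qc simple no_other mu_ac mu_inv [h hE] w [iw [v vE]] w0.
have Ph := transfer_fixes_density mu_ac mu_inv hE.
have lh c := cmeanZ_real c (density_integrable mu_ac) (density_prob mu_ac) hE.
have rev : {ae m, forall x, re v x = w x}.
  by apply: filterS vE => x; rewrite /re => ->.
have lv : cmean v = 0.
  rewrite /cmean (Rintegral_ae_eq (re_integrable v) iw rev) w0.
  rewrite (Rintegral_ae_eq (im_integrable v) (g := fun=> 0)).
  - by rewrite Rintegral_cst// mul0r.
  - exact: integrable0.
  - by apply: filterS vE => x; rewrite /im => ->.
(* Solving with right-hand side [P v] gives [u = P (u + v)]. Duality with [T] commutes with real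
   parts, so [re u] solves the real equation. *)
have [|u uE] := spectral_poisson qc simple no_other Ph (@cmeanB _ _ _ _ B)
  cmean_transfer lh (v := P v).
  by rewrite cmean_transfer.
exists (re u); first exact: in_real_space_re.
move=> G bG.
have bGT : bounded_measurable (G \o T) by exact: bounded_measurable_comp.
have {}uE : u = P (u + v) by rewrite linearD -uE addrC subrK.
rewrite {1}uE -pairing_re_transfer//.
apply: pairing_ae_eq => //; first exact: re_integrable.
- apply: measurable_funD; first exact: re_measurable.
  by move: iw => /measurable_int/measurable_EFinP.
- apply: filterS2 vE (repr_funD u v) => x vx; rewrite /re => ->.
  by rewrite vx; case: (repr_fun u x).
Qed.
End real_poisson.

(** * Laws on the real line and the conclusion *)

Lemma exists_law (R : realType) (d : measure_display) (X : measurableType d)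
    (nu : probability X R) (Z : X -> R) : measurable_fun setT Z ->
  exists Q : probability (measurableTypeR R) R, forall g : R -> R, continuous g ->
    (exists M, forall t, `|g t| <= M) -> \int[Q]_t g t = \int[nu]_x g (Z x).
Proof.
move=> mZ.
have mZ' : @measurable_fun _ _ X (measurableTypeR R) setT Z by [].
pose Zm := isMeasurableFun.Build _ _ X (measurableTypeR R) Z mZ'.
pose ZZ : {mfun X >-> measurableTypeR R} := HB.pack Z Zm.
exists (distribution nu ZZ) => g cg [M gM]; congr fine.
have mg := continuous_measurable_funTR cg.
rewrite (@integral_distribution _ _ _ _ _ nu ZZ (EFin \o g))//.
- exact/measurable_EFinP.
- apply: (@bounded_integrable _ _ _ _ (g \o Z) M) => [|x]; last exact: gM.
  exact: (measurableT_comp mg mZ').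
Qed.

(** At [v = 0] the law is a Dirac mass and both sides equal [cos a], so a single formula lets the
    limit theorem include the degenerate case. *)
Lemma Rintegral_cos_centered_normal (R : realType) (v t a : R) : 0 <= v ->
  \int[centered_normal v]_x cos (t * x - a) = cos a * expR (- (v * t ^+ 2 / 2)).
Proof.
move=> v0; rewrite /centered_normal; case: eqVneq => [->|vn0].
  rewrite /Rintegral integral_dirac//.
    by rewrite diracT mul1e /= mulr0 sub0r cosN !mul0r oppr0 expR0 mulr1.
  apply/measurable_EFinP; apply: continuous_measurable_funTR.
  exact: continuous_cosB.
rewrite Rintegral_cos_normal; last by rewrite gt_eqF// sqrtr_gt0 lt_neqAle eq_sym vn0.
by rewrite exprMn sqr_sqrtr.
Qed.

Theorem theorem2 (R : realType) (d : measure_display) (X : measurableType d)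
    (m : probability X R) (T : {mfun X >-> X})
    (T_nonsingular : pushforward m T `<< m)
    (* conditions on B; the first one is part of L1_banach_space *)
    (B : L1_banach_space m)
    (B_const : forall c : R[i], in_space B (fun=> c))
    (B_algebra : exists2 C : R, 0 < C & forall f g : B, exists2 h : B,
       {ae m, forall x, repr_fun h x = repr_fun f x * repr_fun g x} &
       rnorm h <= C * rnorm f * rnorm g)
    (B_lattice : forall f : B,
       in_space B (fun x => (repr_fun f x)^*%C) /\
       in_space B (fun x => `|repr_fun f x|))
    (* P is the restriction to B of the Perron-Frobenius operator of T *)
    (P : {linear B -> B})
    (P_transfer : forall f : B, {ae m, forall x,
       repr_fun (P f) x = transfer T (repr_fun_integrable f) x})
    (P_bounded : bounded_operator P)
    (P_spectral_radius : spectral_radius P = 1%:E)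
    (P_quasi_compact : quasi_compact_diagonal P)
    (P_simple : simple_eigenvalue P 1)
    (P_no_other : forall z : R[i], is_eigenvalue P z -> `|z| = 1 -> z = 1)
    (* the invariant measure mu *)
    (mu : probability X R)
    (mu_invariant : forall A, measurable A -> mu (T @^-1` A) = mu A)
    (mu_ac : mu `<< m)
    (mu_density : in_space B (fun x => (density m mu x)%:C))
    (* the observable phi *)
    (phi : X -> R)
    (phi_measurable : measurable_fun setT phi)
    (phi_bounded : exists M : R, forall x, `|phi x| <= M)
    (phi_in_B : in_space B (fun x => (phi x)%:C))
    (phi_centered : (\int[mu]_x (phi x)%:E = 0)%E) :
  let normalized_sum n x := birkhoff_sum T phi n x / Num.sqrt n%:R in
  let variance n := (\int[mu]_x (normalized_sum n x ^+ 2))%R in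
  cvgn variance /\
  forall nu : probability X R, nu `<< m ->
    in_space B (fun x => (density m nu x)%:C) ->
    forall g : R -> R, continuous g -> (exists M : R, forall t, `|g t| <= M) ->
      (\int[nu]_x g (normalized_sum n x))%R @[n --> \oo] -->
      (\int[centered_normal (limn variance)]_t g t)%R.
Proof.
move=> normalized_sum variance.
have [M phiM] := phi_bounded.
have mT : measurable_fun setT T by exact: measurable_funPT.
have [C _ alg] := B_algebra.
have conjB (f : B) := (B_lattice f).1.
have bphi : bounded_measurable phi by split => //; exists M.
have E_phi r : in_real_space B r -> in_real_space B (fun x => phi x * r x).
  exact: in_real_spaceM phi_measurable phiM phi_in_B alg.
have E_h : in_real_space B (density m mu).
  by split => //; exact: density_integrable.
have h_inv G : bounded_measurable G ->
    pairing m (G \o T) (density m mu) = pairing m G (density m mu).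
  move=> bG; apply: pairing_comp_of_charge => //; do ?exact: density_integrable.
  move=> A mA; congr fine; rewrite -!density_integral//; last exact: measurable_funPTI.
  by rewrite mu_invariant.
have h_ge0 G : bounded_measurable G -> (forall x, 0 <= G x) ->
    0 <= pairing m G (density m mu).
  by move=> bG G0; rewrite pairing_density// Rintegral_ge0.
have h_phi : \int[m]_x (phi x * density m mu x) = 0.
  by have := pairing_density mu_ac bphi; rewrite /pairing => ->; rewrite /Rintegral phi_centered.
have [v v0 [cvg_var cvg_char]] := @poisson_clt _ X R m T phi (density m mu)
  (in_real_space B) M mT phi_measurable phiM
  (fun r Er => Er.1) (@in_real_space_linear _ _ _ _ B) E_phi E_h (density_prob mu_ac)
  h_inv h_ge0 h_phi (real_poisson T_nonsingular P_transfer conjB P_quasi_compact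
    P_simple P_no_other mu_ac mu_invariant mu_density).
have bZ n : bounded_measurable (normalized_sum n).
  have [mS [K SK]] := bounded_measurable_birkhoff mT phi_measurable phiM n.
  split; first exact: measurable_funM.
  exists (K / Num.sqrt n%:R) => x.
  by rewrite normrM ler_pM// ger0_norm// invr_ge0.
have varE : variance = fun n => pairing m (fun x => normalized_sum n x ^+ 2) (density m mu).
  apply/funext => n; rewrite pairing_density//; exact: bounded_measurableM.
have cv : variance n @[n --> \oo] --> v by rewrite varE.
split; first by apply/cvg_ex; exists v.
rewrite (cvg_lim _ cv)// => nu nu_ac nu_B g cg [Mg gM].
have E_nu : in_real_space B (density m nu).
  by split => //; exact: density_integrable.
(* Weak convergence was proved for probabilities on the line, so each normalized sum is replaced by
   its law under [nu]. *)
have [Q QE] := choice (fun n => exists_law nu (proj1 (bZ n))).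
have -> : (fun n => \int[nu]_x g (normalized_sum n x)) = (fun n => \int[Q n]_t g t).
  by apply/funext => n; rewrite QE//; exists Mg.
apply: (cvg_bounded_continuous _ cg gM) => t a.
rewrite Rintegral_cos_centered_normal//.
have -> : (fun n => \int[Q n]_x cos (t * x - a)) =
    (fun n => pairing m (fun x => cos (t * normalized_sum n x - a)) (density m nu)).
  apply/funext => n; rewrite QE; last 2 first.
  - exact: continuous_cosB.
  - by exists 1 => x; exact: cos_max.
  rewrite pairing_density//; split; last by exists 1 => x; exact: cos_max.
  apply: (measurableT_comp (continuous_measurable_fun (@continuous_cos R))).
  by apply: measurable_funB => //; apply: measurable_funM => //; exact: (proj1 (bZ n)).
exact: cvg_char E_nu (density_prob nu_ac).
Qed.
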